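(* Let $\mathbf{E}\subseteq\mathbf{A}$ be finite symmetric integral relation algebras such that $\mathbf{A}$ is a special extension of $\mathbf{E}$ and $\mathbf{E}$ has a flexible trio. Let $\mathbf{B}$ be the subalgebra of $\mathbf{C}_{\mathbf{E}}(\mathbf{A})$ generated by the set of atoms of $\mathbf{C}_{\mathbf{E}}(\mathbf{A})$. Then: (i) every finitely generated subalgebra of $\mathbf{B}$ is contained in a subalgebra of $\mathbf{B}$ that has the 1-point extension property; (ii) $\mathbf{B}$ is representable; (iii) if $\mathbf{A}$ has no 1-cycles, i.e., $u;u\cdot u=0$ whenever $u$ is an atom of $\mathbf{A}$ with $u\neq 1'$, then $\mathbf{B}$ is not completely representable and the completion of $\mathbf{B}$ is not representable.
   Context: Relation algebras are in the sense of Tarski; $1'$ identity, $0'$ diversity element (complement of $1'$), $;$ relative product, $\overline{x}$ Boolean complement; integral means $1'$ is an atom, symmetric means $x^{\smile}=x$ for all $x$; a diversity atom is an atom below $0'$. A relation algebra is representable if isomorphic to an algebra of binary relations; a representation is complete if it preserves all existing joins; completely representable means having a complete representation. A completion of $\mathbf{B}$ is a complete algebra with $\mathbf{B}$ as a dense subalgebra. Special extension: $\mathbf{A}$ is a special extension of $\mathbf{E}$ if for all diversity atoms $a,b,c$ of $\mathbf{E}$: (1) if not $a=b=c$ and $a;b\ge c$, then $x;y\ge c$ whenever $x,y$ are atoms of $\mathbf{A}$ with $x\le a$, $y\le b$; (2) if $a;a\ge a$ then $x;y\cdot a\ne 0$ whenever $x,y$ are atoms of $\mathbf{A}$ below $a$.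 Flexible trio: diversity atoms $a,b,c$ of a symmetric integral relation algebra with $a;a=b;b=c;c=1$, $a;b=a;c=b;c=0'$, and for every atom $x\notin\{1',a,b,c\}$: ($x;a=x;b=0'$) or ($x;a=x;c=0'$) or ($x;b=x;c=0'$). The algebra $\mathbf{C}_{\mathbf{E}}(\mathbf{A})$: for each atom $x$ of $\mathbf{A}$ let $c(x)$ be the atom of $\mathbf{E}$ with $x\le c(x)$. Let $T(i,j,k)$ for $i,j,k\in\omega$ hold iff $(i\le j=k)$ or $(j\le k=i)$ or $(k\le i=j)$. Let $At=\{1'\}\cup\{x^{(i)}:x$ a diversity atom of $\mathbf{A}$, $i\in\omega\}$. Let $C\subseteq At^3$ consist of all permutations of $(1',1',1')$, $(1',x^{(i)},x^{(i)})$, and $(x^{(i)},y^{(j)},z^{(k)})$ where $x,y,z$ are diversity atoms of $\mathbf{A}$ with $x;y\ge z$ and, if $c(x)=c(y)=c(z)$, then $T(i,j,k)$. $\mathbf{C}_{\mathbf{E}}(\mathbf{A})$ is the algebra of all subsets of $At$ with set Boolean operations, identity $\{1'\}$, converse the identity map, and $X;Y=\{w:\exists u\in X,\exists v\in Y,(u,v,w)\in C\}$; its atoms are the elements of $At$. 1-point extension property (for an atomic relation algebra $\mathbf{A}$): $B_k(\mathbf{A})$ is the set of $\mu:k\times k\to At(\mathbf{A})$ with $\mu_{i,i}\le 1'$, $\mu_{i,j}^{\smile}=\mu_{j,i}$, $\mu_{i,l};\mu_{l,j}\ge\mu_{i,j}$ for all $i,j,l<k$; $\mu$ satisfies the identity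 condition if $\mu_{l,m}=1'$ iff $l=m$. $\mathbf{A}$ has the property if whenever $\mu\in B_k(\mathbf{A})$ satisfies the identity condition, $x,y$ are diversity atoms, $i\ne j<k$ and $\mu_{i,j}\le x;y$, there is $\mu'\in B_{k+1}(\mathbf{A})$ satisfying the identity condition, extending $\mu$, with $\mu'_{i,k}=x$ and $\mu'_{k,j}=y$. *)

(* Defs.v *)
From Stdlib Require Import List Arith.

Record ra_sig := RaSig {
  car   : Type;
  join  : car -> car -> car;
  meet  : car -> car -> car;
  compl : car -> car;
  zero  : car;
  one   : car;
  ident : car;
  conv  : car -> car;
  comp  : car -> car -> car }.

Arguments join {r}. Arguments meet {r}. Arguments compl {r}.
Arguments conv {r}. Arguments comp {r}.

Section Basic.
Variable S : ra_sig.

Definition le (x y : car S) : Prop := join x y = y.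
Definition div : car S := compl (ident S).

Definition is_RA : Prop :=
  (forall x y : car S, join x y = join y x) /\
  (forall x y z : car S, join x (join y z) = join (join x y) z) /\
  (forall x y : car S, meet x y = meet y x) /\
  (forall x y z : car S, meet x (meet y z) = meet (meet x y) z) /\
  (forall x y : car S, join x (meet x y) = x) /\
  (forall x y : car S, meet x (join x y) = x) /\
  (forall x y z : car S, meet x (join y z) = join (meet x y) (meet x z)) /\
  (forall x : car S, join x (compl x) = one S) /\
  (forall x : car S, meet x (compl x) = zero S) /\
  (forall x y z : car S, comp (comp x y) z = comp x (comp y z)) /\
  (forall x y z : car S, comp (join x y) z = join (comp x z) (comp y z)) /\
  (forall x : car S, comp x (ident S) = x) /\
  (forall x : car S, conv (conv x) = x) /\
  (forall x y : car S, conv (join x y) = join (conv x) (conv y)) /\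
  (forall x y : car S, conv (comp x y) = comp (conv y) (conv x)) /\
  (forall x y : car S, join (comp (conv x) (compl (comp x y))) (compl y) = compl y).

Definition subuniverse (P : car S -> Prop) : Prop :=
  P (zero S) /\ P (one S) /\ P (ident S) /\
  (forall x y, P x -> P y -> P (join x y)) /\
  (forall x y, P x -> P y -> P (meet x y)) /\
  (forall x, P x -> P (compl x)) /\
  (forall x, P x -> P (conv x)) /\
  (forall x y, P x -> P y -> P (comp x y)).

Definition generated (G : car S -> Prop) (x : car S) : Prop :=
  forall Q, subuniverse Q -> (forall y, G y -> Q y) -> Q x.

Definition atom_in (P : car S -> Prop) (a : car S) : Prop :=
  P a /\ a <> zero S /\
  forall x, P x -> le x a -> x = zero S \/ x = a.

Definition div_atom_in (P : car S -> Prop) (a : car S) : Prop :=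
  atom_in P a /\ le a div.

Definition atomic_in (P : car S -> Prop) : Prop :=
  forall x, P x -> x <> zero S -> exists a, atom_in P a /\ le a x.

Definition finite_ra : Prop := exists l : list (car S), forall x, In x l.
Definition symmetric_ra : Prop := forall x : car S, conv x = x.
Definition integral_in (P : car S -> Prop) : Prop := atom_in P (ident S).

Definition is_sup_in (P : car S -> Prop) (X : car S -> Prop) (s : car S) : Prop :=
  P s /\ (forall x, X x -> le x s) /\
  (forall t, P t -> (forall x, X x -> le x t) -> le s t).

Definition complete_ra : Prop :=
  forall X : car S -> Prop, exists s, is_sup_in (fun _ => True) X s.

Definition is_rep (P : car S -> Prop) (U : Type) (EU : U -> U -> Prop)
    (h : car S -> U -> U -> Prop) : Prop :=
  (forall u v, EU u v -> EU v u) /\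
  (forall u v w, EU u v -> EU v w -> EU u w) /\
  (forall x, P x -> forall u v, h x u v -> EU u v) /\
  (forall x y, P x -> P y -> forall u v, h (join x y) u v <-> (h x u v \/ h y u v)) /\
  (forall x y, P x -> P y -> forall u v, h (meet x y) u v <-> (h x u v /\ h y u v)) /\
  (forall x, P x -> forall u v, h (compl x) u v <-> (EU u v /\ ~ h x u v)) /\
  (forall u v, h (zero S) u v <-> False) /\
  (forall u v, h (one S) u v <-> EU u v) /\
  (forall u v, h (ident S) u v <-> (EU u v /\ u = v)) /\
  (forall x, P x -> forall u v, h (conv x) u v <-> h x v u) /\
  (forall x y, P x -> P y -> forall u v,
      h (comp x y) u v <-> (exists w, h x u w /\ h y w v)) /\
  (forall x y, P x -> P y -> (forall u v, h x u v <-> h y u v) -> x = y).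

Definition representable_in (P : car S -> Prop) : Prop :=
  exists (U : Type) (EU : U -> U -> Prop) (h : car S -> U -> U -> Prop),
    is_rep P U EU h.

Definition completely_representable_in (P : car S -> Prop) : Prop :=
  exists (U : Type) (EU : U -> U -> Prop) (h : car S -> U -> U -> Prop),
    is_rep P U EU h /\
    forall (X : car S -> Prop) s, (forall x, X x -> P x) -> is_sup_in P X s ->
      forall u v, h s u v <-> exists x, X x /\ h x u v.

Definition in_Bk (P : car S -> Prop) (k : nat) (mu : nat -> nat -> car S) : Prop :=
  forall i j l, i < k -> j < k -> l < k ->
    atom_in P (mu i j) /\ le (mu i i) (ident S) /\ conv (mu i j) = mu j i /\
    le (mu i j) (comp (mu i l) (mu l j)).

Definition identity_cond (k : nat) (mu : nat -> nat -> car S) : Prop :=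
  forall l m, l < k -> m < k -> (mu l m = ident S <-> l = m).

(* the property is defined for atomic relation algebras *)
Definition one_point_ext (P : car S -> Prop) : Prop :=
  atomic_in P /\
  forall k mu x y i j,
    in_Bk P k mu -> identity_cond k mu ->
    div_atom_in P x -> div_atom_in P y ->
    i < k -> j < k -> i <> j -> le (mu i j) (comp x y) ->
    exists mu', in_Bk P (Datatypes.S k) mu' /\ identity_cond (Datatypes.S k) mu' /\
      (forall l m, l < k -> m < k -> mu' l m = mu l m) /\
      mu' i k = x /\ mu' k j = y.
End Basic.

Arguments le {S}. Arguments div {S}.

Definition embedding (S D : ra_sig) (P : car S -> Prop) (e : car S -> car D) : Prop :=
  (forall x y, P x -> P y -> e (join x y) = join (e x) (e y)) /\
  (forall x y, P x -> P y -> e (meet x y) = meet (e x) (e y)) /\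
  (forall x, P x -> e (compl x) = compl (e x)) /\
  e (zero S) = zero D /\ e (one S) = one D /\ e (ident S) = ident D /\
  (forall x, P x -> e (conv x) = conv (e x)) /\
  (forall x y, P x -> P y -> e (comp x y) = comp (e x) (e y)) /\
  (forall x y, P x -> P y -> e x = e y -> x = y).

Definition completion_of (S : ra_sig) (P : car S -> Prop) (D : ra_sig) : Prop :=
  is_RA D /\ complete_ra D /\
  exists e : car S -> car D, embedding S D P e /\
    forall d, d <> zero D -> exists b, P b /\ e b <> zero D /\ le (e b) d.

Section Ext.
Variable A : ra_sig.
Variable PE : car A -> Prop.   (* universe of the subalgebra E of A *)

Definition special_extension : Prop :=
  (forall a b c, div_atom_in A PE a -> div_atom_in A PE b -> div_atom_in A PE c ->
     ~ (a = b /\ b = c) -> le c (comp a b) ->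
     forall x y, atom_in A (fun _ => True) x -> atom_in A (fun _ => True) y ->
       le x a -> le y b -> le c (comp x y)) /\
  (forall a, div_atom_in A PE a -> le a (comp a a) ->
     forall x y, atom_in A (fun _ => True) x -> atom_in A (fun _ => True) y ->
       le x a -> le y a -> meet (comp x y) a <> zero A).

Definition flexible_trio (a b c : car A) : Prop :=
  div_atom_in A PE a /\ div_atom_in A PE b /\ div_atom_in A PE c /\
  comp a a = one A /\ comp b b = one A /\ comp c c = one A /\
  comp a b = div /\ comp a c = div /\ comp b c = div /\
  forall x, atom_in A PE x -> x <> ident A -> x <> a -> x <> b -> x <> c ->
    (comp x a = div /\ comp x b = div) \/
    (comp x a = div /\ comp x c = div) \/
    (comp x b = div /\ comp x c = div).

Definition has_flexible_trio : Prop := exists a b c, flexible_trio a b c.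

Definition DAt : Type := { x : car A | div_atom_in A (fun _ => True) x }.
(* None = 1', Some (x, i) = x^(i) *)
Definition At : Type := option (DAt * nat).

(* c(x) = c(y) = c(z): the three atoms of A lie below the same atom of E *)
Definition same_c (x y z : car A) : Prop :=
  exists e, atom_in A PE e /\ le x e /\ le y e /\ le z e.

Definition Tr (i j k : nat) : Prop :=
  (i <= j /\ j = k) \/ (j <= k /\ k = i) \/ (k <= i /\ i = j).

Definition Cbase (u v w : At) : Prop :=
  match u, v, w with
  | None, None, None => True
  | None, Some p, Some q => p = q
  | Some (x, i), Some (y, j), Some (z, k) =>
      le (proj1_sig z) (comp (proj1_sig x) (proj1_sig y)) /\
      (same_c (proj1_sig x) (proj1_sig y) (proj1_sig z) -> Tr i j k)
  | _, _, _ => False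
  end.

Definition Ctri (u v w : At) : Prop :=
  Cbase u v w \/ Cbase u w v \/ Cbase v u w \/
  Cbase v w u \/ Cbase w u v \/ Cbase w v u.

Definition CEA : ra_sig := {|
  car   := At -> Prop;
  join  := fun X Y w => X w \/ Y w;
  meet  := fun X Y w => X w /\ Y w;
  compl := fun X w => ~ X w;
  zero  := fun _ => False;
  one   := fun _ => True;
  ident := fun w => w = None;
  conv  := fun X => X;
  comp  := fun X Y w => exists u v, X u /\ Y v /\ Ctri u v w |}.

Definition Bsub : car CEA -> Prop :=
  generated CEA (atom_in CEA (fun _ => True)).
End Ext.

(* Main.v *)
Require Import Defs.
From Stdlib Require Import List Arith.
From Stdlib Require Import Lia Classical ClassicalEpsilon
  FunctionalExtensionality PropExtensionality ProofIrrelevance Cantor.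
Import ListNotations.

(* Write [c x] for the atom of E above [x].  A product [x^(i);y^(j)] meets each
   class [{z^(k) : c z = e}] in nothing, in everything, or, when
   [c x = c y = e], in finitely many points.  Hence every element of B is
   finite or cofinite in each class, and it respects, for some [n], the
   equivalence identifying the points of one class with index at least [n].
   The elements of B respecting this equivalence form a subalgebra, in which the
   members [f] of the flexible trio yield atoms [{z^(k) : z <= f, k >= n}].  Any
   two diversity atoms admit one of these that can label all remaining edges at
   a new point, whence the 1-point extension property.  Adding to the atoms one
   limit label per class and building a countable saturated graph step by step
   represents B.  For the negative part, colour the edge of a pair related by
   [x^(i)] (or, in a completion, by the supremum of all [x^(i)]) with [x]: there
   are finitely many colours and infinitely many points, so Ramsey's theorem
   gives a monochromatic triangle, hence [x <= x;x]. *)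

(** * Combinatorics *)

Definition infinite (X : nat -> Prop) : Prop := forall n, exists m, n <= m /\ X m.

Lemma infinite_pigeonhole (K : Type) (l : list K) (R : K -> nat -> Prop)
    (X : nat -> Prop) :
  infinite X -> (forall m, X m -> exists c, In c l /\ R c m) ->
  exists c, In c l /\ infinite (fun m => X m /\ R c m).
Proof.
  intros HX HR. apply NNPP. intros Hno.
  assert (Hb : exists N, forall c, In c l -> forall m, N <= m -> ~ (X m /\ R c m)).
  { clear HR. induction l as [|c l IH].
    - exists 0. intros c [].
    - destruct IH as [N HN].
      { intros [d [Hd Hi]]. apply Hno. exists d. split; [now right|exact Hi]. }
      assert (Hc : ~ infinite (fun m => X m /\ R c m)).
      { intros Hi. apply Hno. exists c. split; [now left|exact Hi]. }
      apply not_all_ex_not in Hc as [N' HN'].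
      exists (max N N'). intros d [<-|Hd] m Hm Hm'.
      + apply HN'. exists m. split; [lia|exact Hm'].
      + apply (HN d Hd m); [lia|exact Hm']. }
  destruct Hb as [N HN]. destruct (HX N) as [m [Hm Xm]].
  destruct (HR m Xm) as [c [Hc Rc]]. exact (HN c Hc m Hm (conj Xm Rc)).
Qed.

Lemma ramsey_triangle (K : Type) (R : K -> nat -> nat -> Prop) (l : list K)
    (X : nat -> Prop) :
  infinite X ->
  (forall i j, X i -> X j -> i < j -> exists c, In c l /\ R c i j) ->
  exists c i j k, i < j < k /\ R c i j /\ R c j k /\ R c i k.
Proof.
  remember (length l) as n eqn:Hn. revert l Hn X.
  induction n as [|n IH]; intros l Hn X HX HR;
    destruct (HX 0) as [i [_ Xi]].
  { destruct (HX (S i)) as [j [Hj Xj]].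
    destruct (HR i j Xi Xj Hj) as [c [Hc _]].
    destruct l; [destruct Hc|discriminate]. }
  destruct (infinite_pigeonhole K l (fun c => R c i) (fun j => X j /\ i < j))
    as [c [Hc HN]].
  { intros m. destruct (HX (max m (S i))) as [j [Hj Xj]].
    exists j. repeat split; [lia|exact Xj|lia]. }
  { intros j [Xj Hj]. exact (HR i j Xi Xj Hj). }
  destruct (classic (exists j k, (X j /\ i < j) /\ (X k /\ i < k) /\ j < k /\
    R c i j /\ R c i k /\ R c j k)) as [(j & k & H)|Hno].
  { exists c, i, j, k. intuition. }
  destruct (in_split c l Hc) as [l1 [l2 ->]].
  apply (IH (l1 ++ l2)) with (X := fun m => (X m /\ i < m) /\ R c i m);
    [|exact HN|].
  { rewrite length_app in *. simpl in Hn. lia. }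
  intros j k [Xj Rj] [Xk Rk] Hjk.
  destruct (HR j k (proj1 Xj) (proj1 Xk) Hjk) as [d [Hd Rd]].
  exists d. split; [|exact Rd].
  apply in_app_iff in Hd as [Hd|[<-|Hd]]; apply in_app_iff; auto.
  exfalso. apply Hno. exists j, k. intuition.
Qed.

(** Repetitions in the list are counted, which is harmless: only strict monotonicity matters, for a
    measure in the descent to atoms. *)
Definition count {T : Type} (X : T -> Prop) (l : list T) : nat :=
  length (filter (fun x => if excluded_middle_informative (X x) then true else false) l).

Lemma count_le (T : Type) (X Y : T -> Prop) (l : list T) :
  (forall x, X x -> Y x) -> count X l <= count Y l.
Proof.
  intros HXY. unfold count. induction l as [|x l IH]; simpl; [lia|].
  destruct (excluded_middle_informative (X x)) as [Hx|Hx];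
    destruct (excluded_middle_informative (Y x)) as [Hy|Hy]; simpl; try lia.
  exfalso; auto.
Qed.

Lemma count_lt (T : Type) (X Y : T -> Prop) (l : list T) (x : T) :
  (forall x, X x -> Y x) -> In x l -> Y x -> ~ X x -> count X l < count Y l.
Proof.
  intros HXY Hin HY HX. induction l as [|y l IH]; [destruct Hin|].
  assert (Hle := count_le T X Y l HXY). unfold count in *. simpl.
  destruct (excluded_middle_informative (X y)) as [Hx|Hx];
    destruct (excluded_middle_informative (Y y)) as [Hy|Hy]; simpl;
    destruct Hin as [->|Hin]; try specialize (IH Hin); try lia;
    exfalso; auto.
Qed.

(** * Extending symmetric networks over an abstract set of labels *)

Section LabelledGraphs.
Variables (L : Type) (V : L -> Prop) (id : L) (T : L -> L -> L -> Prop).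
Hypothesis Vid : V id.
Hypothesis T_swap : forall p q r, T p q r -> T q p r.
Hypothesis T_rot : forall p q r, T p q r -> T q r p.
Hypothesis T_id : forall p q, V p -> V q -> (T id p q <-> p = q).

Definition diversity (p : L) : Prop := V p /\ p <> id.

(** The source of both positive results: [f] can fill all unspecified edges at a new point. The
    instances are the atoms of a tame subalgebra and the labels of the representation. *)
Hypothesis flexible : forall p q, diversity p -> diversity q ->
  exists f, diversity f /\
    forall r, diversity r -> T f f r /\ T p f r /\ T q f r.

Definition net (k : nat) (M : nat -> nat -> L) : Prop :=
  forall i j, i < k -> j < k ->
    V (M i j) /\ (M i j = id <-> i = j) /\ M i j = M j i /\
    forall l, l < k -> T (M i l) (M l j) (M i j).

Definition extend (k : nat) (M : nat -> nat -> L) (row : nat -> L) (i j : nat) : L :=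
  if i =? k then if j =? k then id else row j
  else if j =? k then row i else M i j.

(** Only triangles through the new point [k] are new. The symmetries of [T] bring each of them to
    two row entries over an old edge, or to a triangle containing [id]. *)
Lemma net_extend (k : nat) (M : nat -> nat -> L) (row : nat -> L) :
  net k M -> (forall l, l < k -> diversity (row l)) ->
  (forall l m, l < k -> m < k -> l <> m -> T (row l) (row m) (M l m)) ->
  net (S k) (extend k M row).
Proof.
  intros HM HD HT.
  assert (Hrow : forall l m, l < k -> m < k -> T (row l) (row m) (M l m)).
  { intros l m Hl Hm. destruct (Nat.eq_dec l m) as [<-|Hlm]; [|now apply HT].
    replace (M l l) with id.
    - apply T_rot, T_id; try apply HD; auto.
    - symmetry. now apply HM. }
  intros i j Hi Hj. unfold extend.
  destruct (Nat.eqb_spec i k) as [Eik|Nik]; destruct (Nat.eqb_spec j k) as [Ejk|Njk].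
  - repeat split; intros; subst; auto.
    destruct (Nat.eqb_spec l k) as [Elk|Nlk].
    + now apply T_id.
    + apply T_rot, T_id; try apply HD; auto; lia.
  - assert (D : diversity (row j)) by (apply HD; lia). destruct D as [D1 D2].
    repeat split; intros; subst; auto; try lia; try contradiction.
    destruct (Nat.eqb_spec l k) as [Elk|Nlk].
    + now apply T_id.
    + apply T_rot, T_swap, Hrow; lia.
  - assert (D : diversity (row i)) by (apply HD; lia). destruct D as [D1 D2].
    repeat split; intros; subst; auto; try lia; try contradiction.
    destruct (Nat.eqb_spec l k) as [Elk|Nlk].
    + apply T_swap. now apply T_id.
    + apply T_rot, T_rot, T_swap, Hrow; lia.
  - assert (Hi' : i < k) by lia. assert (Hj' : j < k) by lia.
    destruct (HM i j Hi' Hj') as (H1 & H2 & H3 & H4).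
    repeat split; intros; auto; try now apply H2.
    destruct (Nat.eqb_spec l k) as [Elk|Nlk]; [apply Hrow; auto|apply H4; lia].
Qed.

(* All edges from the new point to points other than [i], [j] get one and the
   same label, flexible with respect to both [p] and [q]. *)
Lemma one_point_extension (k : nat) (M : nat -> nat -> L) (p q : L) (i j : nat) :
  net k M -> diversity p -> diversity q -> i < k -> j < k -> T p q (M i j) ->
  exists M', net (S k) M' /\ (forall l m, l < k -> m < k -> M' l m = M l m) /\
    M' i k = p /\ M' k j = q.
Proof.
  intros HM Hp Hq Hi Hj HT.
  destruct (flexible p q Hp Hq) as [f [Hf Hflex]].
  (* Requests at a loop are allowed. Then [M i i] is [id], so the two labels agree and one row entry
     meets both demands. *)
  assert (Hij : i = j -> p = q).
  { intros <-. apply T_id; try apply Hp; try apply Hq.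
    replace id with (M i i); [|now apply HM]. auto. }
  set (row := fun l => if l =? i then p else if l =? j then q else f).
  exists (extend k M row). refine (conj _ (conj _ (conj _ _))).
  - apply net_extend; auto.
    + intros l _. unfold row.
      destruct (l =? i); [exact Hp|]. destruct (l =? j); [exact Hq|exact Hf].
    + intros l m Hl Hm Hlm.
      assert (D : diversity (M l m)).
      { split; [now apply HM|]. intros E. apply Hlm. now apply (HM l m Hl Hm). }
      destruct (Hflex _ D) as (F1 & F2 & F3).
      unfold row.
      destruct (Nat.eqb_spec l i) as [->|Nli]; destruct (Nat.eqb_spec m i) as [->|Nmi];
        try contradiction.
      * destruct (Nat.eqb_spec m j) as [->|Nmj]; auto.
      * destruct (Nat.eqb_spec l j) as [->|Nlj]; auto.
        rewrite (proj1 (proj2 (proj2 (HM j i Hj Hi)))). auto.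
      * destruct (Nat.eqb_spec l j) as [->|Nlj];
          destruct (Nat.eqb_spec m j) as [->|Nmj]; try contradiction; auto.
  - intros l m Hl Hm. unfold extend.
    destruct (Nat.eqb_spec l k); [lia|]. destruct (Nat.eqb_spec m k); [lia|]. reflexivity.
  - unfold extend, row. rewrite Nat.eqb_refl.
    destruct (Nat.eqb_spec i k); [lia|]. now rewrite Nat.eqb_refl.
  - unfold extend, row. rewrite Nat.eqb_refl.
    destruct (Nat.eqb_spec j k); [lia|].
    destruct (Nat.eqb_spec j i); [auto|]. now rewrite Nat.eqb_refl.
Qed.

(** Stage [k] is a network on [k] points, and the next stage answers request number [k] by its new
    point. Each request has a code beyond its two vertices, so it comes up when both are present. *)
Lemma saturated_graph (enum : nat -> L) (p0 : L) :
  diversity p0 ->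
  (forall p, exists n, enum n = p) ->
  exists G : nat -> nat -> L, (forall k, net k G) /\
    forall u v p q, diversity p -> diversity q -> T p q (G u v) ->
      exists w, G u w = p /\ G w v = q.
Proof.
  intros Hp0 Henum.
  (* The discarded second component is padding: the value [S (u + v)] pushes the code of a request
     beyond its vertices. *)
  set (ask := fun n => let '(c, _) := of_nat n in let '(a, b) := of_nat c in
    (of_nat a, (enum (fst (of_nat b)), enum (snd (of_nat b))))).
  assert (Hask : forall u v p q, exists n, u < n /\ v < n /\ ask n = ((u, v), (p, q))).
  { intros u v p q. destruct (Henum p) as [a Ha]. destruct (Henum q) as [b Hb].
    exists (to_nat (to_nat (to_nat (u, v), to_nat (a, b)), S (u + v))).
    assert (H := to_nat_non_decreasing
      (to_nat (to_nat (u, v), to_nat (a, b))) (S (u + v))).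
    split; [lia|]. split; [lia|]. unfold ask. rewrite !cancel_of_to. simpl.
    now rewrite Ha, Hb. }
  set (answers := fun k M M' => net (S k) M' /\
    (forall l m, l < k -> m < k -> M' l m = M l m) /\
    forall u v p q, ask k = ((u, v), (p, q)) -> diversity p -> diversity q ->
      u < k -> v < k -> T p q (M u v) -> M' u k = p /\ M' k v = q).
  assert (Hstep : forall k M, exists M', 0 < k -> net k M -> answers k M M').
  { intros k M. destruct (ask k) as [[u v] [p q]] eqn:Ek.
    destruct (classic (0 < k /\ net k M)) as [[Hk HM]|Hno];
      [|exists M; tauto].
    destruct (classic (diversity p /\ diversity q /\ u < k /\ v < k /\ T p q (M u v)))
      as [(Hp & Hq & Hu & Hv & HT)|Hno].
    - destruct (one_point_extension k M p q u v) as [M' (H1 & H2 & H3 & H4)]; auto.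
      exists M'. intros _ _. split; [exact H1|]. split; [exact H2|].
      intros u' v' p' q' E. rewrite Ek in E. injection E as <- <- <- <-. tauto.
    (* A request that cannot be met is replaced by a loop request for [p0] at the point 0, so that
       every step still adds a point. *)
    - destruct (one_point_extension k M p0 p0 0 0) as [M' (H1 & H2 & H3 & H4)]; auto.
      { replace (M 0 0) with id; [|symmetry; now apply HM].
        apply T_rot, T_id; try apply Hp0; auto. }
      exists M'. intros _ _. split; [exact H1|]. split; [exact H2|].
      intros u' v' p' q' E. rewrite Ek in E. injection E as <- <- <- <-. tauto. }
  set (step := fun k M => proj1_sig (constructive_indefinite_description _ (Hstep k M))).
  assert (step_spec : forall k M, 0 < k -> net k M -> answers k M (step k M)).
  { intros k M. exact (proj2_sig (constructive_indefinite_description _ (Hstep k M))). }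
  set (stage := fix stage k := match k with
    | 0 => fun _ _ => id
    | S k' => match k' with 0 => fun _ _ => id | S _ => step k' (stage k') end
    end).
  assert (stage_net : forall k, net k (stage k)).
  { induction k as [|[|k] IH].
    - intros i j Hi. lia.
    - intros i j Hi Hj. simpl. repeat split; auto; try lia.
      intros l Hl. now apply T_id.
    - apply (step_spec (S k) (stage (S k))); [lia|exact IH]. }
  assert (stage_stable : forall d k i j, i < k -> j < k -> stage (d + k) i j = stage k i j).
  { induction d as [|d IH]; intros k i j Hi Hj; [reflexivity|].
    rewrite <- (IH k i j Hi Hj).
    destruct (d + k) as [|k'] eqn:Ek; [lia|].
    replace (S d + k) with (S (S k')) by lia.
    apply (step_spec (S k') (stage (S k'))); auto; lia. }
  set (G := fun i j => stage (S (max i j)) i j).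
  assert (HG : forall k i j, i < k -> j < k -> G i j = stage k i j).
  { intros k i j Hi Hj. unfold G.
    rewrite <- (stage_stable (k - S (max i j)) (S (max i j))) by lia.
    now replace (k - S (max i j) + S (max i j)) with k by lia. }
  exists G. split.
  - intros k i j Hi Hj. rewrite (HG k i j), (HG k j i) by assumption.
    destruct (stage_net k i j Hi Hj) as (H1 & H2 & H3 & H4).
    repeat split; auto; try now apply H2.
    intros l Hl. rewrite (HG k i l), (HG k l j) by assumption. auto.
  - intros u v p q Hp Hq HT. destruct (Hask u v p q) as (n & Hu & Hv & E).
    destruct n as [|n]; [lia|].
    destruct (step_spec (S n) (stage (S n)) ltac:(lia) (stage_net (S n)))
      as (_ & _ & H).
    rewrite (HG (S n)) in HT by assumption.
    destruct (H u v p q E Hp Hq Hu Hv HT) as [H1 H2].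
    exists (S n). rewrite !(HG (S (S n))) by lia. split; [exact H1|exact H2].
Qed.
End LabelledGraphs.

(** * Relation algebras *)

(** Descent: a nonzero element that is not an atom has a smaller nonzero one in [P]. The lemma is
    phrased through the order alone so as to cover both finite algebras and the tame subalgebras of
    [C]. *)
Lemma atomic_of_measure (S : ra_sig) (P : car S -> Prop) (m : car S -> nat) :
  (forall x : car S, le x x) ->
  (forall x y z : car S, le x y -> le y z -> le x z) ->
  (forall x y, P x -> P y -> le y x -> y <> x -> m y < m x) -> atomic_in S P.
Proof.
  intros Hrefl Htrans Hm x. remember (m x) as n eqn:En. revert x En.
  induction n as [n IH] using lt_wf_ind. intros x -> Px Nx.
  destruct (classic (atom_in S P x)) as [Hx|Hx].
  { exists x. split; [exact Hx|apply Hrefl]. }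
  destruct (classic (exists y, P y /\ le y x /\ y <> zero S /\ y <> x))
    as [(y & Py & Hy & Ny & Nyx)|Hno].
  - destruct (IH (m y) (Hm x y Px Py Hy Nyx) y eq_refl Py Ny) as [a [Ha Hay]].
    exists a. split; [exact Ha|]. now apply Htrans with y.
  - exfalso. apply Hx. split; [exact Px|]. split; [exact Nx|].
    intros y Py Hy. apply NNPP. intros Hn. apply Hno. exists y. tauto.
Qed.

Lemma subuniverse_join S P x y : subuniverse S P -> P x -> P y -> P (join x y).
Proof. intros H. apply H. Qed.

Lemma subuniverse_meet S P x y : subuniverse S P -> P x -> P y -> P (meet x y).
Proof. intros H. apply H. Qed.

Lemma subuniverse_compl S P x : subuniverse S P -> P x -> P (compl x).
Proof. intros H. apply H. Qed.

Lemma subuniverse_comp S P x y : subuniverse S P -> P x -> P y -> P (comp x y).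
Proof. intros H. apply H. Qed.

Section RelationAlgebra.
Variable S : ra_sig.
Hypothesis HS : is_RA S.
Implicit Types x y z : car S.

Let joinC : forall x y, join x y = join y x := proj1 HS.
Let joinA : forall x y z, join x (join y z) = join (join x y) z.
Proof. apply HS. Qed.
Let meetC : forall x y, meet x y = meet y x.
Proof. apply HS. Qed.
Let meetA : forall x y z, meet x (meet y z) = meet (meet x y) z.
Proof. apply HS. Qed.
Let joinK : forall x y, join x (meet x y) = x.
Proof. apply HS. Qed.
Let meetK : forall x y, meet x (join x y) = x.
Proof. apply HS. Qed.
Let meet_join_l : forall x y z, meet x (join y z) = join (meet x y) (meet x z).
Proof. apply HS. Qed.
Let join_compl : forall x, join x (compl x) = one S.
Proof. apply HS. Qed.
Let meet_compl : forall x, meet x (compl x) = zero S.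
Proof. apply HS. Qed.
Let comp_join_l : forall x y z, comp (join x y) z = join (comp x z) (comp y z).
Proof. apply HS. Qed.
Let conv_comp : forall x y, conv (comp x y) = comp (conv y) (conv x).
Proof. apply HS. Qed.

Lemma ra_le_refl x : le x x.
Proof. unfold le. rewrite <- (meetK x x) at 2. apply joinK. Qed.

Lemma ra_le_trans x y z : le x y -> le y z -> le x z.
Proof. unfold le. intros H1 H2. now rewrite <- H2, joinA, H1. Qed.

Lemma ra_le_antisym x y : le x y -> le y x -> x = y.
Proof. unfold le. intros H1 H2. rewrite <- H1, joinC. now symmetry. Qed.

Lemma ra_le_meetE x y : le x y <-> meet x y = x.
Proof.
  unfold le. split; intros H.
  - rewrite <- H. apply meetK.
  - rewrite <- H, joinC, meetC. apply joinK.
Qed.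

Lemma ra_meet_glb x y z : le z x -> le z y -> le z (meet x y).
Proof. rewrite !ra_le_meetE. intros H1 H2. now rewrite meetA, H1. Qed.

Lemma ra_meet_l x y : le (meet x y) x.
Proof. unfold le. rewrite joinC. apply joinK. Qed.

Lemma ra_meet_r x y : le (meet x y) y.
Proof. rewrite meetC. apply ra_meet_l. Qed.

Lemma ra_zero_le x : le (zero S) x.
Proof. rewrite <- (meet_compl x). apply ra_meet_l. Qed.

Lemma ra_le_one x : le x (one S).
Proof. rewrite <- (join_compl x). unfold le. now rewrite joinA, (ra_le_refl x). Qed.

Lemma ra_le_zero x : le x (zero S) -> x = zero S.
Proof. intros H. apply ra_le_antisym; [exact H|apply ra_zero_le]. Qed.

Lemma ra_le_compl_of_disjoint x y : meet x y = zero S -> le x (compl y).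
Proof.
  intros H. apply ra_le_meetE. rewrite <- (proj1 (ra_le_meetE _ _) (ra_le_one x)) at 2.
  rewrite <- (join_compl y), meet_join_l, H. symmetry. apply ra_zero_le.
Qed.

Lemma ra_le_contradict x y : le x y -> le x (compl y) -> x = zero S.
Proof.
  intros H1 H2. apply ra_le_zero. rewrite <- (meet_compl y). now apply ra_meet_glb.
Qed.

Lemma ra_atom_cases (P : car S -> Prop) x y :
  subuniverse S P -> atom_in S P x -> P y -> le x y \/ le x (compl y).
Proof.
  intros HP [Px [_ Hx]] Py.
  destruct (Hx (meet x y)) as [E|E].
  - now apply HP.
  - apply ra_meet_l.
  - right. now apply ra_le_compl_of_disjoint.
  - left. now apply ra_le_meetE.
Qed.

Lemma ra_comp_mono_l x y z : le x y -> le (comp x z) (comp y z).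
Proof. unfold le. intros H. now rewrite <- comp_join_l, H. Qed.

Hypothesis Hsym : symmetric_ra S.

Lemma ra_comp_comm x y : comp x y = comp y x.
Proof. rewrite <- (Hsym (comp x y)), conv_comp. now rewrite !Hsym. Qed.

Lemma ra_comp_mono x x' y y' : le x x' -> le y y' -> le (comp x y) (comp x' y').
Proof.
  intros H1 H2. apply ra_le_trans with (comp x' y); [now apply ra_comp_mono_l|].
  rewrite (ra_comp_comm x' y), (ra_comp_comm x' y'). now apply ra_comp_mono_l.
Qed.

Lemma ra_full_subuniverse : subuniverse S (fun _ => True).
Proof. unfold subuniverse. tauto. Qed.

(** Otherwise [y] lies below the complement of [x;z], and Tarski's last axiom gives
    [z <= x;y <= x;-(x;z) <= -z], against [z] being nonzero. *)
Lemma ra_atom_cycle x y z :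
  atom_in S (fun _ => True) x -> atom_in S (fun _ => True) y ->
  atom_in S (fun _ => True) z -> le z (comp x y) -> le y (comp x z).
Proof.
  intros Hx Hy Hz H.
  destruct (ra_atom_cases _ y (comp x z) ra_full_subuniverse Hy I) as [|Hn]; [assumption|].
  exfalso. apply Hz. apply ra_le_contradict with z; [apply ra_le_refl|].
  apply ra_le_trans with (comp x y); [exact H|].
  apply ra_le_trans with (comp x (compl (comp x z))).
  - apply ra_comp_mono; [apply ra_le_refl|exact Hn].
  - rewrite <- (Hsym x) at 1. apply HS.
Qed.

Lemma finite_atomic (P : car S -> Prop) : finite_ra S -> atomic_in S P.
Proof.
  intros [l Hl]. apply atomic_of_measure with (fun x => count (fun y => le y x) l);
    [exact ra_le_refl|exact ra_le_trans|].
  intros x y _ _ Hyx Nyx. apply count_lt with x; auto.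
  - intros z Hz. now apply ra_le_trans with y.
  - apply ra_le_refl.
  - intros Hxy. apply Nyx. now apply ra_le_antisym.
Qed.

Lemma finite_smallest_above (P : car S -> Prop) x :
  finite_ra S -> subuniverse S P ->
  exists y, P y /\ le x y /\ forall z, P z -> le x z -> le y z.
Proof.
  intros [l Hl] HP.
  assert (H : exists y, P y /\ le x y /\ forall z, In z l -> P z -> le x z -> le y z).
  { clear Hl. induction l as [|a l IH].
    - exists (one S). split; [apply HP|]. split; [apply ra_le_one|]. intros z [].
    - destruct IH as (y & Py & Hy & Hmin).
      destruct (classic (P a /\ le x a)) as [[Pa Ha]|Hno].
      + exists (meet y a). split; [now apply HP|]. split; [now apply ra_meet_glb|].
        intros z [<-|Hz] Pz Hxz; [apply ra_meet_r|].
        apply ra_le_trans with y; [apply ra_meet_l|auto].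
      + exists y. split; [exact Py|]. split; [exact Hy|].
        intros z [<-|Hz] Pz Hxz; [tauto|auto]. }
  destruct H as (y & H1 & H2 & H3). exists y. auto.
Qed.

(** The least element of [P] above [x] is an atom of [P]: an element of [P] below it either contains
    [x] and so equals it, or has a complement containing [x] and so is zero. *)
Lemma finite_atom_above (P : car S -> Prop) x :
  finite_ra S -> subuniverse S P -> atom_in S (fun _ => True) x ->
  exists e, atom_in S P e /\ le x e.
Proof.
  intros Hfin HP Hx.
  destruct (finite_smallest_above P x Hfin HP) as (e & Pe & He & Hmin).
  exists e. split; [|exact He]. split; [exact Pe|]. split.
  - intros E. apply Hx. apply ra_le_zero. now rewrite <- E.
  - intros y Py Hy.
    destruct (ra_atom_cases _ x y ra_full_subuniverse Hx I) as [H|H].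
    + right. apply ra_le_antisym; auto.
    + left. apply ra_le_contradict with y; [apply ra_le_refl|].
      apply ra_le_trans with e; [exact Hy|]. apply Hmin; [now apply HP|exact H].
Qed.
End RelationAlgebra.

(** * Atoms of A and their classes in E *)

Lemma rep_mono (S : ra_sig) P U EU h (x y : car S) :
  is_rep S P U EU h -> P x -> P y -> le x y -> forall u v, h x u v -> h y u v.
Proof.
  intros (_ & _ & _ & Hjoin & _) Px Py Hle u v Hx.
  unfold le in Hle. rewrite <- Hle. apply Hjoin; auto.
Qed.

Section SpecialExtension.
Variables (A : ra_sig) (PE : car A -> Prop).
Hypothesis HA : is_RA A.
Hypothesis Afin : finite_ra A.
Hypothesis Asym : symmetric_ra A.
Hypothesis Aint : integral_in A (fun _ => True).
Hypothesis HE : subuniverse A PE.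
Hypothesis Hspecial : special_extension A PE.
Hypothesis Htrio : has_flexible_trio A PE.

Local Notation D := (DAt A).

Definition tri (x y z : D) : Prop :=
  le (proj1_sig z) (comp (proj1_sig x) (proj1_sig y)).

Lemma DAt_eq (x y : D) : proj1_sig x = proj1_sig y -> x = y.
Proof.
  destruct x as [x Hx], y as [y Hy]. simpl. intros <-.
  now rewrite (proof_irrelevance _ Hx Hy).
Qed.

Lemma DAt_atom (x : D) : atom_in A (fun _ => True) (proj1_sig x).
Proof. apply (proj2_sig x). Qed.

Lemma tri_swap x y z : tri x y z -> tri y x z.
Proof. unfold tri. now rewrite (ra_comp_comm A HA Asym). Qed.

Lemma tri_swap_r x y z : tri x y z -> tri x z y.
Proof. apply (ra_atom_cycle A HA Asym); apply DAt_atom. Qed.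

Lemma class_exists (x : D) : exists e, div_atom_in A PE e /\ le (proj1_sig x) e.
Proof.
  destruct (finite_atom_above A HA PE (proj1_sig x) Afin HE (DAt_atom x)) as (e & He & Hxe).
  exists e. split; [|exact Hxe]. split; [exact He|].
  destruct (ra_atom_cases A HA PE e (ident A) HE He) as [H|H]; [apply HE| |exact H].
  exfalso. apply (proj1 (proj2 (DAt_atom x))). apply (ra_le_contradict A HA) with (ident A).
  - now apply (ra_le_trans A HA) with e.
  - apply (proj2_sig x).
Qed.

(** The map [c] of the construction on diversity atoms; the choice is harmless by [cls_unique]. *)
Definition cls (x : D) : car A :=
  proj1_sig (constructive_indefinite_description _ (class_exists x)).

Lemma cls_spec x : div_atom_in A PE (cls x) /\ le (proj1_sig x) (cls x).
Proof. exact (proj2_sig (constructive_indefinite_description _ (class_exists x))). Qed.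

Lemma cls_unique x e : atom_in A PE e -> le (proj1_sig x) e -> cls x = e.
Proof.
  intros He Hx. destruct (cls_spec x) as [[Hc _] Hxc].
  destruct (ra_atom_cases A HA PE e (cls x) HE He) as [H|H]; [apply Hc| |].
  - destruct (proj2 (proj2 Hc) e) as [E|E]; [apply He|exact H| |now symmetry].
    exfalso. now apply (proj1 (proj2 He)).
  - exfalso. apply (proj1 (proj2 (DAt_atom x))). apply (ra_le_contradict A HA) with (cls x).
    + exact Hxc.
    + now apply (ra_le_trans A HA) with e.
Qed.

Lemma cls_onto e : div_atom_in A PE e -> exists x, cls x = e.
Proof.
  intros [He Hd]. destruct (finite_atomic A HA (fun _ => True) Afin e I) as [a [Ha Hae]];
    [apply He|].
  assert (Hda : div_atom_in A (fun _ => True) a).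
  { split; [exact Ha|]. now apply (ra_le_trans A HA) with e. }
  exists (exist _ a Hda). now apply cls_unique.
Qed.

Lemma same_c_cls (x y z : D) :
  same_c A PE (proj1_sig x) (proj1_sig y) (proj1_sig z) <-> cls x = cls y /\ cls y = cls z.
Proof.
  split.
  - intros (e & He & Hx & Hy & Hz).
    now rewrite (cls_unique x e), (cls_unique y e), (cls_unique z e).
  - intros [E1 E2]. exists (cls x). split; [apply cls_spec|].
    split; [apply cls_spec|]. rewrite E1. split; [apply cls_spec|].
    rewrite E2. apply cls_spec.
Qed.

(** The product lies in E, so the atom [cls z] is below it or below its complement; the nonzero [z]
    excludes the latter. *)
Lemma atom_le_product z a b :
  PE a -> PE b -> le (proj1_sig z) (comp a b) -> le (cls z) (comp a b).
Proof.
  intros Ha Hb H. destruct (cls_spec z) as [[Hc _] Hzc].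
  destruct (ra_atom_cases A HA PE (cls z) (comp a b) HE Hc) as [|Hn]; [now apply HE|assumption|].
  exfalso. apply (proj1 (proj2 (DAt_atom z))). apply (ra_le_contradict A HA) with (comp a b).
  - exact H.
  - now apply (ra_le_trans A HA) with (cls z).
Qed.

Lemma tri_cls x y z : tri x y z -> le (cls z) (comp (cls x) (cls y)).
Proof.
  intros H. apply atom_le_product; try apply cls_spec.
  apply (ra_le_trans A HA) with (comp (proj1_sig x) (proj1_sig y)); [exact H|].
  apply (ra_comp_mono A HA Asym); apply cls_spec.
Qed.

Lemma tri_of_cls x y z :
  ~ (cls x = cls y /\ cls y = cls z) -> le (cls z) (comp (cls x) (cls y)) -> tri x y z.
Proof.
  intros Hne H. apply (ra_le_trans A HA) with (cls z); [apply cls_spec|].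
  apply (proj1 Hspecial) with (cls x) (cls y); try apply cls_spec; auto;
    apply DAt_atom.
Qed.

(** Condition (1) of special extensions: unless all three classes coincide, a triangle depends only
    on the classes of its sides. *)
Lemma tri_mixed x y z x' y' z' :
  ~ (cls x = cls y /\ cls y = cls z) -> tri x y z ->
  cls x' = cls x -> cls y' = cls y -> cls z' = cls z -> tri x' y' z'.
Proof.
  intros Hne H Ex Ey Ez. apply tri_of_cls; rewrite Ex, Ey, Ez; [exact Hne|].
  now apply tri_cls.
Qed.

(** Condition (2) of special extensions provides an atom of A below both [x;z] and [e]; by the cycle
    law it serves as second side. *)
Lemma tri_loop e x z :
  le e (comp e e) -> cls x = e -> cls z = e -> exists y, cls y = e /\ tri x y z.
Proof.
  intros He Hx Hz.
  assert (De : div_atom_in A PE e) by (rewrite <- Hx; apply cls_spec).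
  destruct (finite_atomic A HA (fun _ => True) Afin
    (meet (comp (proj1_sig x) (proj1_sig z)) e) I) as [a [Ha Hae]].
  { apply (proj2 Hspecial); auto; try apply DAt_atom.
    - rewrite <- Hx. apply cls_spec.
    - rewrite <- Hz. apply cls_spec. }
  assert (Hae' : le a e).
  { eapply (ra_le_trans A HA); [exact Hae|apply (ra_meet_r A HA)]. }
  assert (Hda : div_atom_in A (fun _ => True) a).
  { split; [exact Ha|]. apply (ra_le_trans A HA) with e; [exact Hae'|apply De]. }
  exists (exist _ a Hda). split.
  - apply cls_unique; [apply De|exact Hae'].
  - apply tri_swap_r. eapply (ra_le_trans A HA); [exact Hae|apply (ra_meet_l A HA)].
Qed.

Lemma tri_same x y z x' z' :
  cls x = cls y -> cls y = cls z -> tri x y z -> cls x' = cls x -> cls z' = cls x ->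
  exists y', cls y' = cls x /\ tri x' y' z'.
Proof.
  intros E1 E2 H Ex Ez. apply tri_loop; auto.
  apply tri_cls in H. now rewrite <- E2, <- E1 in H.
Qed.

(** Distinctness of the classes keeps such triangles free of the index condition [Tr] as well. *)
Definition loose (e f : car A) : Prop :=
  e <> f /\ forall x y z, cls x = e -> cls y = f -> tri x y z.

(** What [f;f = 1] yields on atoms of A: a third side outside the class goes with any two sides from
    it, whereas one inside needs a second side adapted to it. *)
Definition flexible_class (f : car A) : Prop :=
  (forall x y z, cls x = f -> cls y = f -> cls z <> f -> tri x y z) /\
  (forall x z, cls x = f -> cls z = f -> exists y, cls y = f /\ tri x y z).

Lemma trio_loose e f : e <> f -> comp e f = div -> loose e f.
Proof.
  intros Nef H. split; [exact Nef|]. intros x y z Ex Ey. apply tri_of_cls; rewrite Ex, Ey.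
  - now intros [E _].
  - rewrite H. apply cls_spec.
Qed.

Lemma trio_flexible f : comp f f = one A -> flexible_class f.
Proof.
  intros H. split.
  - intros x y z Ex Ey Nz. apply tri_of_cls; rewrite Ex, Ey.
    + intros [_ E]. now apply Nz.
    + rewrite H. apply (ra_le_one A HA).
  - intros x z Ex Ez. apply tri_loop; auto. rewrite H. apply (ra_le_one A HA).
Qed.

(** Each class is loose towards at least two members of the trio, and two pairs out of three members
    have one in common. *)
Lemma flexible_class_exists (u1 u2 : D) :
  exists f, flexible_class (cls f) /\ loose (cls u1) (cls f) /\ loose (cls u2) (cls f).
Proof.
  destruct Htrio as (a & b & c & Ha & Hb & Hc & Haa & Hbb & Hcc & Hab & Hac & Hbc & Hx).
  (* The members of the trio are distinct: [x = y] would give [1 = 0'], so [1' <= 0']. *)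
  assert (Hne : forall x y : car A, comp x x = one A -> comp x y = div -> x <> y).
  { intros x y Hxx Hxy <-. rewrite Hxx in Hxy.
    apply (proj1 (proj2 Aint)). apply (ra_le_contradict A HA) with (ident A).
    - apply (ra_le_refl A HA).
    - change (compl (ident A)) with (@div A). rewrite <- Hxy. apply (ra_le_one A HA). }
  assert (Hl : forall e, div_atom_in A PE e ->
    loose e a /\ loose e b \/ loose e a /\ loose e c \/ loose e b /\ loose e c).
  { assert (Hba : comp b a = div) by now rewrite (ra_comp_comm A HA Asym).
    assert (Hca : comp c a = div) by now rewrite (ra_comp_comm A HA Asym).
    assert (Hcb : comp c b = div) by now rewrite (ra_comp_comm A HA Asym).
    intros e [He Hd].
    destruct (classic (e = a)) as [->|Na]; [right; right; split; apply trio_loose; auto|].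
    destruct (classic (e = b)) as [->|Nb]; [right; left; split; apply trio_loose; auto|].
    destruct (classic (e = c)) as [->|Nc]; [left; split; apply trio_loose; auto|].
    destruct (Hx e) as [[H1 H2]|[[H1 H2]|[H1 H2]]]; auto.
    - intros ->. apply (proj1 (proj2 Aint)).
      apply (ra_le_contradict A HA) with (ident A); [apply (ra_le_refl A HA)|exact Hd].
    - left. split; apply trio_loose; auto.
    - right; left. split; apply trio_loose; auto.
    - right; right. split; apply trio_loose; auto. }
  assert (Hf : forall f, div_atom_in A PE f -> comp f f = one A ->
    loose (cls u1) f -> loose (cls u2) f ->
    exists g, flexible_class (cls g) /\ loose (cls u1) (cls g) /\ loose (cls u2) (cls g)).
  { intros f Df Hff H1 H2. destruct (cls_onto f Df) as [g <-].
    exists g. split; [now apply trio_flexible|auto]. }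
  destruct (Hl (cls u1) (proj1 (cls_spec u1))) as [[H1 H2]|[[H1 H2]|[H1 H2]]];
    destruct (Hl (cls u2) (proj1 (cls_spec u2))) as [[K1 K2]|[[K1 K2]|[K1 K2]]];
    solve [apply (Hf a); auto|apply (Hf b); auto|apply (Hf c); auto].
Qed.

Lemma DAt_inhabited : inhabited D.
Proof.
  destruct Htrio as (a & b & c & Ha & _). destruct (cls_onto a Ha) as [x _]. now constructor.
Qed.

Lemma DAt_finite : exists l : list D, forall x, In x l.
Proof.
  destruct Afin as [l Hl].
  assert (H : exists l' : list D, forall x : D, In (proj1_sig x) l -> In x l').
  { clear Hl. induction l as [|a l [l' IH]].
    - exists []. intros x [].
    - destruct (classic (div_atom_in A (fun _ => True) a)) as [Ha|Hna].
      + exists (exist _ a Ha :: l'). intros x [E|Hin]; [left|right; auto].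
        now apply DAt_eq.
      + exists l'. intros x [E|Hin]; [|auto]. exfalso. apply Hna. rewrite E.
        apply (proj2_sig x). }
  destruct H as [l' H]. exists l'. auto.
Qed.

(** * The algebra [C]: triangles of points, labels and truncation *)

Local Notation C := (CEA A PE).
Local Notation Pt := (At A).

Lemma set_eq (X Y : car C) : (forall w, X w <-> Y w) -> X = Y.
Proof.
  intros H. apply functional_extensionality. intros w. now apply propositional_extensionality.
Qed.

Lemma set_le (X Y : car C) : le X Y <-> forall w, X w -> Y w.
Proof.
  unfold le; simpl. split.
  - intros <- w Hw. now left.
  - intros H. apply set_eq. intros w. intuition.
Qed.

(** The closure under permutations in [Ctri] adds nothing here, since [tri] and [Tr] are themselves
    symmetric: [Tr] says that the largest of the three indices is attained at least twice. *)
Lemma ctri_points (x y z : D) i j k :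
  Ctri A PE (Some (x, i)) (Some (y, j)) (Some (z, k)) <->
  tri x y z /\ (cls x = cls y /\ cls y = cls z -> Tr i j k).
Proof.
  assert (TrC : forall i j k, Tr i j k -> Tr j i k /\ Tr i k j) by (unfold Tr; lia).
  unfold Ctri, Cbase. rewrite !same_c_cls. fold (tri x y z) (tri x z y) (tri y x z) (tri y z x)
    (tri z x y) (tri z y x).
  split; [|now left].
  intros H; repeat destruct H as [[H1 H2]|H]; try destruct H as [H1 H2];
    (split; [eauto 6 using tri_swap, tri_swap_r|]);
    intros [E1 E2]; (eassert (Tr _ _ _) by (apply H2; split; congruence)); revert H; unfold Tr; lia.
Qed.

Lemma ctri_ident_l (v w : Pt) : Ctri A PE None v w <-> v = w.
Proof.
  unfold Ctri, Cbase. destruct v as [[x i]|], w as [[y j]|]; split;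
    intuition congruence.
Qed.

Lemma ctri_swap u v w : Ctri A PE u v w -> Ctri A PE v u w.
Proof. unfold Ctri. tauto. Qed.

Lemma ctri_rot u v w : Ctri A PE u v w -> Ctri A PE v w u.
Proof. unfold Ctri. tauto. Qed.

Lemma ctri_ident_r (u v : Pt) : Ctri A PE u v None <-> u = v.
Proof.
  rewrite <- ctri_ident_l. split; intros H.
  - now apply ctri_rot, ctri_rot.
  - now apply ctri_rot.
Qed.

Lemma ctri_mixed (x y z : D) i j k :
  ~ (cls x = cls y /\ cls y = cls z) -> tri x y z ->
  Ctri A PE (Some (x, i)) (Some (y, j)) (Some (z, k)).
Proof. intros Hne H. apply ctri_points. tauto. Qed.

(* [Limit e] stands for the points [x^(i)] with [x] below [e] and [i] arbitrarily
   large; at level [n] it denotes the points with [i >= n], which [red n]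
   identifies. *)
Inductive label : Type := Point (u : Pt) | Limit (e : car A).

Definition mem (n : nat) (p : label) (u : Pt) : Prop :=
  match p with
  | Point v => v = u
  | Limit e => exists x i, u = Some (x, i) /\ cls x = e /\ n <= i
  end.

Definition valid (p : label) : Prop :=
  match p with Point _ => True | Limit e => div_atom_in A PE e end.

(** Labels double as names of truncation classes: [mem n (red n u)] is the equivalence class of [u]
    at level [n]. *)
Definition red (n : nat) (u : Pt) : label :=
  match u with
  | Some (x, i) => if n <=? i then Limit (cls x) else Point u
  | None => Point None
  end.

Lemma mem_mono n m p u : n <= m -> mem m p u -> mem n p u.
Proof.
  intros Hnm. destruct p as [v|e]; [exact (fun H => H)|].
  intros (x & i & Eu & Ex & Hi). exists x, i. repeat split; auto; lia.
Qed.

Lemma mem_nonempty n p : valid p -> exists u, mem n p u.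
Proof.
  destruct p as [u|e]; [now exists u|].
  intros He. destruct (cls_onto e He) as [x Hx]. exists (Some (x, n)), x, n. auto.
Qed.

Lemma red_valid n u : valid (red n u).
Proof.
  destruct u as [[x i]|]; simpl; [|exact I].
  destruct (n <=? i); simpl; [apply cls_spec|exact I].
Qed.

Lemma mem_red n u : mem n (red n u) u.
Proof.
  destruct u as [[x i]|]; simpl; [|reflexivity].
  destruct (Nat.leb_spec n i); simpl; [|reflexivity]. exists x, i. auto.
Qed.

Lemma mem_red_eq n m u v : n <= m -> mem m (red n u) v -> red n v = red n u.
Proof.
  intros Hnm. destruct u as [[x i]|]; simpl; [|now intros <-].
  destruct (Nat.leb_spec n i); simpl.
  - intros (y & j & -> & Ey & Hj). simpl. rewrite <- Ey.
    destruct (Nat.leb_spec n j); [reflexivity|lia].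
  - intros <-. simpl. destruct (Nat.leb_spec n i); [lia|reflexivity].
Qed.

Lemma mem_red_point n m x i v :
  mem m (red n (Some (x, i))) v -> exists y j, v = Some (y, j) /\ cls y = cls x.
Proof.
  simpl. destruct (n <=? i); simpl.
  - intros (y & j & -> & Ey & _). now exists y, j.
  - intros <-. now exists x, i.
Qed.

(** The back property of truncation. The case [m = n] makes composition preserve tame sets; larger
    [m] lifts one triangle of points to triangles of labels. Mixed classes leave all choices free;
    in a single class [tri_same] finds the atoms and only the indices need care. *)
Lemma ctri_refine n m u v w w' :
  n <= m -> Ctri A PE u v w -> mem m (red n w) w' ->
  exists u' v', mem m (red n u) u' /\ mem m (red n v) v' /\ Ctri A PE u' v' w'.
Proof.
  intros Hnm Huvw Hw'.
  destruct u as [[x i]|].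
  2:{ apply ctri_ident_l in Huvw as <-. exists None, w'.
      split; [reflexivity|]. split; [exact Hw'|]. now apply ctri_ident_l. }
  destruct v as [[y j]|].
  2:{ apply ctri_swap, ctri_ident_l in Huvw as <-. exists w', None.
      split; [exact Hw'|]. split; [reflexivity|]. now apply ctri_swap, ctri_ident_l. }
  destruct w as [[z k]|].
  2:{ apply ctri_ident_r in Huvw as <-.
      destruct (mem_nonempty m _ (red_valid n (Some (x, i)))) as [u' Hu'].
      exists u', u'. split; [exact Hu'|]. split; [exact Hu'|].
      simpl in Hw'. subst w'. now apply ctri_ident_r. }
  apply ctri_points in Huvw as [Ht HT].
  destruct (mem_red_point _ _ _ _ _ Hw') as (z' & k' & -> & Ez).
  destruct (classic (cls x = cls y /\ cls y = cls z)) as [[E1 E2]|Hne].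
  2:{ destruct (mem_nonempty m _ (red_valid n (Some (x, i)))) as [u' Hu'].
      destruct (mem_nonempty m _ (red_valid n (Some (y, j)))) as [v' Hv'].
      exists u', v'. split; [exact Hu'|]. split; [exact Hv'|].
      destruct (mem_red_point _ _ _ _ _ Hu') as (x' & i' & -> & Ex).
      destruct (mem_red_point _ _ _ _ _ Hv') as (y' & j' & -> & Ey).
      apply ctri_mixed; [congruence|]. now apply tri_mixed with x y z. }
  specialize (HT (conj E1 E2)).
  assert (Hx : forall x', cls x' = cls x -> exists y', cls y' = cls x /\ tri x' y' z').
  { intros x' Ex. apply tri_same with y z; congruence. }
  assert (Hy : forall y', cls y' = cls x -> exists x', cls x' = cls x /\ tri x' y' z').
  { intros y' Ey. destruct (Hx y' Ey) as (x' & Ex & H). exists x'.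
    split; [exact Ex|now apply tri_swap]. }
  simpl in Hw' |- *.
  (* The maximal index occurs twice, so it cannot be that exactly one index reaches [n]; five cases
     remain. First and second sides that reach [n] get the index of [w'] if [w] reaches [n] too, and
     [m] otherwise. *)
  destruct (Nat.leb_spec n i) as [Hi|Hi]; destruct (Nat.leb_spec n j) as [Hj|Hj];
    destruct (Nat.leb_spec n k) as [Hk|Hk]; simpl in Hw' |- *;
    try (exfalso; unfold Tr in HT; lia).
  - destruct Hw' as (z'' & k'' & E & _ & Hk'). injection E as <- <-.
    destruct (Hx x eq_refl) as (y' & Ey & H).
    exists (Some (x, k')), (Some (y', k')).
    split; [exists x, k'; auto|]. split; [exists y', k'; split; [auto|split; [congruence|auto]]|].
    apply ctri_points. split; [exact H|]. intros _. unfold Tr. lia.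
  - injection Hw' as <- <-. destruct (Hx x eq_refl) as (y' & Ey & H).
    exists (Some (x, m)), (Some (y', m)).
    split; [exists x, m; auto|]. split; [exists y', m; split; [auto|split; [congruence|auto]]|].
    apply ctri_points. split; [exact H|]. intros _. unfold Tr. lia.
  - destruct Hw' as (z'' & k'' & E & _ & Hk'). injection E as <- <-.
    destruct (Hy y (eq_sym E1)) as (x' & Ex & H).
    exists (Some (x', k')), (Some (y, j)).
    split; [exists x', k'; auto|]. split; [reflexivity|].
    apply ctri_points. split; [exact H|]. intros _. unfold Tr. lia.
  - destruct Hw' as (z'' & k'' & E & _ & Hk'). injection E as <- <-.
    destruct (Hx x eq_refl) as (y' & Ey & H).
    exists (Some (x, i)), (Some (y', k')).
    split; [reflexivity|]. split; [exists y', k'; split; [auto|split; [congruence|auto]]|].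
    apply ctri_points. split; [exact H|]. intros _. unfold Tr. lia.
  - injection Hw' as <- <-. exists (Some (x, i)), (Some (y, j)).
    split; [reflexivity|]. split; [reflexivity|]. apply ctri_points. auto.
Qed.

(** * Tame sets: unions of truncation classes *)

Definition tame (n : nat) (X : car C) : Prop :=
  forall u v, red n u = red n v -> X u -> X v.

Lemma mem_limit n e u : mem n (Limit e) u <-> red n u = Limit e.
Proof.
  split.
  - intros (x & i & -> & <- & Hi). simpl. destruct (Nat.leb_spec n i); [reflexivity|lia].
  - intros <-. apply mem_red.
Qed.

Lemma tame_mono n m X : n <= m -> tame n X -> tame m X.
Proof.
  intros Hnm HX u v E. apply HX.
  assert (Hv : mem m (red m u) v) by (rewrite E; apply mem_red).
  symmetry. apply (mem_red_eq n n); [lia|].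
  destruct u as [[x i]|]; simpl in Hv |- *; [|exact Hv].
  destruct (Nat.leb_spec m i); destruct (Nat.leb_spec n i); simpl in *; auto; try lia.
  - destruct Hv as (y & j & -> & Ey & Hj). exists y, j. repeat split; auto; lia.
  - subst v. exists x, i. auto.
Qed.

Lemma tame_subuniverse n : subuniverse C (tame n).
Proof.
  unfold tame. refine (conj _ (conj _ (conj _ (conj _ (conj _ (conj _ (conj _ _))))))); simpl.
  - intros u v E H. exact H.
  - auto.
  - intros u v E ->. assert (H := mem_red n v). rewrite <- E in H. symmetry. exact H.
  - intros X Y HX HY u v E [H|H]; [left; now apply HX with u|right; now apply HY with u].
  - intros X Y HX HY u v E [H H']. split; [now apply HX with u|now apply HY with u].
  - intros X HX u v E HXu HXv. apply HXu. now apply HX with v.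
  - auto.
  - intros X Y HX HY w w' E (u & v & Hu & Hv & Huvw).
    destruct (ctri_refine n n u v w w' (le_n n) Huvw) as (u' & v' & Hu' & Hv' & H).
    { rewrite E. apply mem_red. }
    exists u', v'. split; [|split; [|exact H]].
    + apply HX with u; [|exact Hu]. symmetry. now apply (mem_red_eq n n).
    + apply HY with v; [|exact Hv]. symmetry. now apply (mem_red_eq n n).
Qed.

(** * The subalgebra B *)

Local Notation B := (Bsub A PE).

Definition point (u : Pt) : car C := fun w => w = u.

Lemma point_atom u : atom_in C (fun _ => True) (point u).
Proof.
  split; [exact I|]. split.
  - intros E. assert (H : point u u) by reflexivity. now rewrite E in H.
  - intros Y _ HY. rewrite set_le in HY. destruct (classic (Y u)) as [Hu|Hu].
    + right. apply set_eq. intros w. split; [apply HY|]. now intros ->.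
    + left. apply set_eq. intros w. split; [|intros []]. intros Hw. apply Hu.
      now rewrite <- (HY w Hw).
Qed.

Lemma nonempty (X : car C) : X <> zero C -> exists w, X w.
Proof.
  intros HX. apply NNPP. intros Hno. apply HX. apply set_eq. intros w.
  split; [|intros []]. intros Hw. apply Hno. now exists w.
Qed.

Lemma atom_point X : atom_in C (fun _ => True) X -> exists u, X = point u.
Proof.
  intros (_ & NX & HX). destruct (nonempty X NX) as [u Hu]. exists u.
  destruct (HX (point u) I) as [E|E].
  - apply set_le. now intros w ->.
  - exfalso. now apply (point_atom u).
  - now symmetry.
Qed.

Lemma B_subuniverse : subuniverse C B.
Proof.
  refine (conj _ (conj _ (conj _ (conj _ (conj _ (conj _ (conj _ _))))))); intros; intros Q HQ HG;
    assert (HB : forall X, B X -> Q X) by (intros X HX; now apply HX);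
    destruct HQ as (? & ? & ? & ? & ? & ? & ? & ?); auto.
Qed.

Lemma B_point u : B (point u).
Proof. intros Q _ HQ. apply HQ, point_atom. Qed.

(** Induction on generation. The point [x^(i)] is a truncation class of its own from level [i + 1]
    on, and two levels can be raised to their maximum. *)
Lemma B_tame X : B X -> exists n, tame n X.
Proof.
  intros HX. apply HX.
  - assert (H2 : forall X Y, (exists n, tame n X) -> (exists n, tame n Y) ->
      exists n, tame n X /\ tame n Y).
    { intros Y Z [n Hn] [m Hm]. exists (max n m).
      split; [apply tame_mono with n|apply tame_mono with m]; auto; lia. }
    refine (conj _ (conj _ (conj _ (conj _ (conj _ (conj _ (conj _ _))))))).
    + exists 0. exact (proj1 (tame_subuniverse 0)).
    + exists 0. exact (proj1 (proj2 (tame_subuniverse 0))).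
    + exists 0. exact (proj1 (proj2 (proj2 (tame_subuniverse 0)))).
    + intros Y Z HY HZ. destruct (H2 Y Z HY HZ) as (n & Hn & Hm). exists n.
      apply subuniverse_join; auto using tame_subuniverse.
    + intros Y Z HY HZ. destruct (H2 Y Z HY HZ) as (n & Hn & Hm). exists n.
      apply subuniverse_meet; auto using tame_subuniverse.
    + intros Y [n HY]. exists n. apply subuniverse_compl; auto using tame_subuniverse.
    + intros Y HY. exact HY.
    + intros Y Z HY HZ. destruct (H2 Y Z HY HZ) as (n & Hn & Hm). exists n.
      apply subuniverse_comp; auto using tame_subuniverse.
  - intros Y HY. destruct (atom_point Y HY) as [[[x i]|] ->].
    + assert (Hr : red (S i) (Some (x, i)) = Point (Some (x, i))).
      { unfold red. destruct (Nat.leb_spec (S i) i); [lia|reflexivity]. }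
      exists (S i). intros u v E ->. rewrite Hr in E.
      assert (Hv := mem_red (S i) v). rewrite <- E in Hv. symmetry. exact Hv.
    + exists 0. intros u v E ->. assert (H := mem_red 0 v). rewrite <- E in H. symmetry. exact H.
Qed.

Lemma B_finite (l : list Pt) : B (fun w => In w l).
Proof.
  induction l as [|u l IH].
  - exact (proj1 B_subuniverse).
  - replace (fun w => In w (u :: l)) with (@join C (point u) (fun w => In w l)).
    + apply subuniverse_join; [exact B_subuniverse|apply B_point|exact IH].
    + apply set_eq. intros w. simpl. unfold point. intuition.
Qed.

(** Capping the index at [N] does not change the truncation class. *)
Lemma representatives N : exists l : list Pt, forall u, exists r, In r l /\ red N r = red N u.
Proof.
  destruct DAt_finite as [l Hl].
  exists (None :: map Some (list_prod l (seq 0 (S N)))).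
  intros [[x i]|].
  - exists (Some (x, min i N)). split.
    + right. apply in_map, in_prod; [apply Hl|]. apply in_seq. lia.
    + simpl. destruct (Nat.leb_spec N (min i N)); destruct (Nat.leb_spec N i); try lia;
        [reflexivity|]. now rewrite Nat.min_l by lia.
  - exists None. split; [now left|reflexivity].
Qed.

(* Up to finitely many points, the class of [f] is the complement of the
   square of any atom of [C] in that class. *)
Lemma B_limit f n : flexible_class (cls f) -> B (mem (S n) (Limit (cls f))).
Proof.
  intros [Hf _]. destruct DAt_finite as [l Hl].
  set (low := map Some (list_prod l (seq 0 (S n))) : list Pt).
  (* The square of [f^(n)] contains the identity and, by flexibility, all other classes. Inside its
     own class [Tr n n k] forces [k <= n], and [low] removes the remaining points up to [n]. *)
  replace (mem (S n) (Limit (cls f))) with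
    (@meet C (compl (comp (point (Some (f, n))) (point (Some (f, n))))) (@compl C (fun w => In w low))).
  - assert (HB := B_subuniverse). apply subuniverse_meet; [exact HB| |].
    + apply subuniverse_compl; [exact HB|].
      apply subuniverse_comp; [exact HB|apply B_point|apply B_point].
    + apply subuniverse_compl; [exact HB|apply B_finite].
  - apply set_eq. intros w. simpl. unfold point. split.
    + intros [H1 H2]. destruct w as [[z k]|].
      * exists z, k. split; [reflexivity|]. split.
        -- apply NNPP. intros Nz. apply H1. do 2 eexists. split; [reflexivity|].
           split; [reflexivity|]. apply ctri_mixed; [intuition congruence|]. now apply Hf.
        -- apply NNPP. intros Hk. apply H2, in_map, in_prod; [apply Hl|].
           apply in_seq. lia.
      * exfalso. apply H1. do 2 eexists. split; [reflexivity|].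
        split; [reflexivity|]. now apply ctri_ident_r.
    + intros (z & k & -> & Ez & Hk). split.
      * intros (u & v & -> & -> & H). apply ctri_points in H as [_ H].
        assert (Tr n n k) by (apply H; split; congruence). unfold Tr in *. lia.
      * intros H. apply in_map_iff in H as [[z' k'] [E Hin]]. injection E as -> ->.
        apply in_prod_iff in Hin as [_ Hin]. apply in_seq in Hin. lia.
Qed.

(** The common source of the hypothesis [flexible] in both instances: far out points of a flexible
    class towards which both given classes are loose. *)
Lemma flexible_limit (x1 x2 : D) :
  exists f, flexible_class (cls f) /\ forall n z k,
    (exists u v, mem n (Limit (cls f)) u /\ mem n (Limit (cls f)) v /\
      Ctri A PE u v (Some (z, k))) /\
    (forall y i, cls y = cls x1 \/ cls y = cls x2 ->
      exists v, mem n (Limit (cls f)) v /\ Ctri A PE (Some (y, i)) v (Some (z, k))).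
Proof.
  destruct (flexible_class_exists x1 x2) as (f & Hf & [N1 L1] & [N2 L2]).
  exists f. split; [exact Hf|]. intros n z k. destruct Hf as [Hf1 Hf2]. split.
  - destruct (classic (cls z = cls f)) as [Ez|Nz].
    + destruct (Hf2 f z eq_refl Ez) as (y & Ey & H).
      (* All three classes coincide, so [Tr] must hold: two equal indices that are at least [k]
         ensure it. *)
      exists (Some (f, max n k)), (Some (y, max n k)).
      split; [exists f, (max n k); repeat split; lia|].
      split; [exists y, (max n k); repeat split; [exact Ey|lia]|].
      apply ctri_points. split; [exact H|]. unfold Tr. lia.
    + exists (Some (f, n)), (Some (f, n)).
      split; [exists f, n; auto|]. split; [exists f, n; auto|].
      apply ctri_mixed; [intuition congruence|auto].
  - intros y i Hy. exists (Some (f, n)). split; [exists f, n; auto|].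
    apply ctri_mixed; [intuition congruence|]. destruct Hy; auto.
Qed.

(** * The elements of [B] of a fixed level and the 1-point extension property *)

Section TameSubalgebra.
Variable N : nat.

(** The level is a successor because [B_limit] yields the limit sets at successor levels. *)
Definition Blevel (X : car C) : Prop := B X /\ tame (S N) X.

Lemma Blevel_subuniverse : subuniverse C Blevel.
Proof.
  assert (HB := B_subuniverse). assert (HT := tame_subuniverse (S N)).
  unfold Blevel, subuniverse in *. intuition.
Qed.

Lemma set_le_refl (X : car C) : le X X.
Proof. now apply set_le. Qed.

Lemma set_le_trans (X Y Z : car C) : le X Y -> le Y Z -> le X Z.
Proof. rewrite !set_le. auto. Qed.

(** Shrinking a set of this level removes a whole truncation class, hence one of finitely many
    representatives. *)
Lemma Blevel_atomic : atomic_in C Blevel.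
Proof.
  destruct (representatives (S N)) as [l Hl].
  apply atomic_of_measure with (fun X => count X l);
    [exact set_le_refl|exact set_le_trans|].
  intros X Y [_ HX] [_ HY] Hle Hne. rewrite set_le in Hle.
  assert (Hw : exists w, X w /\ ~ Y w).
  { apply NNPP. intros Hno. apply Hne, set_eq. intros w. split; [apply Hle|].
    intros Xw. apply NNPP. intros Yw. apply Hno. now exists w. }
  destruct Hw as (w & Xw & Yw). destruct (Hl w) as (r & Hr & E).
  apply count_lt with r; auto.
  - now apply HX with w.
  - intros Yr. apply Yw. now apply HY with r.
Qed.

Lemma Blevel_atoms_meet X Y w :
  atom_in C Blevel X -> Blevel Y -> X w -> Y w -> le X Y.
Proof.
  intros (QX & _ & HX) QY Xw Yw. destruct (HX (meet X Y)) as [E|E].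
  - apply subuniverse_meet; auto using Blevel_subuniverse.
  - apply set_le. now intros v [].
  - assert (H : @meet C X Y w) by now split. rewrite E in H. destruct H.
  - rewrite <- E. apply set_le. now intros v [].
Qed.

Lemma Blevel_atoms_eq X Y w :
  atom_in C Blevel X -> atom_in C Blevel Y -> X w -> Y w -> X = Y.
Proof.
  intros HX HY Xw Yw.
  assert (H1 := Blevel_atoms_meet X Y w HX (proj1 HY) Xw Yw).
  assert (H2 := Blevel_atoms_meet Y X w HY (proj1 HX) Yw Xw).
  rewrite set_le in H1, H2. apply set_eq. intros v. split; auto.
Qed.

Lemma Blevel_ident_atom : atom_in C Blevel (ident C).
Proof.
  split; [exact (proj1 (proj2 (proj2 Blevel_subuniverse)))|]. split; [exact (proj1 (proj2 (point_atom None)))|].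
  intros X _. exact (proj2 (proj2 (point_atom None)) X I).
Qed.

Definition set_tri (X Y Z : car C) : Prop :=
  exists u v w, X u /\ Y v /\ Z w /\ Ctri A PE u v w.

(** The product belongs to the subalgebra, so an atom that meets it lies below it, and a single
    triangle suffices. The form [set_tri] makes the permutation symmetry evident. *)
Lemma Blevel_triE X Y Z : atom_in C Blevel X -> atom_in C Blevel Y -> atom_in C Blevel Z ->
  (le Z (comp X Y) <-> set_tri X Y Z).
Proof.
  intros HX HY HZ. split.
  - rewrite set_le. intros H. destruct (nonempty Z (proj1 (proj2 HZ))) as [w Zw].
    destruct (H w Zw) as (u & v & Xu & Yv & Huvw). now exists u, v, w.
  - intros (u & v & w & Xu & Yv & Zw & H). apply Blevel_atoms_meet with w; auto.
    + apply subuniverse_comp; [exact Blevel_subuniverse|apply HX|apply HY].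
    + now exists u, v.
Qed.

Lemma Blevel_diversity X w : diversity (car C) (atom_in C Blevel) (ident C) X -> X w ->
  exists x i, w = Some (x, i).
Proof.
  intros [HX Hne] Xw. destruct w as [[x i]|]; [now exists x, i|].
  exfalso. apply Hne. apply Blevel_atoms_eq with None; auto using Blevel_ident_atom. reflexivity.
Qed.

(** This set is one truncation class, so no tame set of this level can split it. *)
Lemma Blevel_limit f : flexible_class (cls f) ->
  diversity (car C) (atom_in C Blevel) (ident C) (mem (S N) (Limit (cls f))).
Proof.
  intros Hf.
  assert (Hmem : mem (S N) (Limit (cls f)) (Some (f, S N))) by (exists f, (S N); auto).
  split; [split; [|split]|].
  - split; [now apply B_limit|]. intros u v E. rewrite !mem_limit. congruence.
  - intros E. now rewrite E in Hmem.
  - intros X [_ HX] Hle. rewrite set_le in Hle.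
    destruct (classic (exists w, X w)) as [[w Xw]|Hno].
    + right. apply set_eq. intros v. split; [apply Hle|]. intros Hv.
      apply HX with w; [|exact Xw]. specialize (Hle w Xw).
      rewrite mem_limit in Hle, Hv. congruence.
    + left. apply set_eq. intros v. split; [|intros []]. intros Xv. apply Hno. now exists v.
  - intros E. rewrite E in Hmem. discriminate.
Qed.

(** An instance of [one_point_extension] with atoms as labels. The flexible atom comes from
    [flexible_limit], applied to one point of each of the two given atoms. *)
Lemma Blevel_one_point_ext : one_point_ext C Blevel.
Proof.
  split; [exact Blevel_atomic|].
  intros k mu X Y i j HB Hid HX HY Hi Hj Hij HXY.
  assert (Hdiv : forall Z, div_atom_in C Blevel Z -> diversity (car C) (atom_in C Blevel) (ident C) Z).
  { intros Z [HZ Hd]. split; [exact HZ|]. intros E. rewrite set_le, E in Hd.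
    now apply (Hd None). }
  assert (Hnet : net (car C) (atom_in C Blevel) (ident C) set_tri k mu).
  { intros l m Hl Hm. split; [now apply (HB l m l)|]. split; [now apply Hid|].
    split; [now apply (HB l m l)|]. intros p Hp.
    apply Blevel_triE; [apply (HB l p l)|apply (HB p m l)|apply (HB l m p)|apply (HB l m p)]; auto. }
  destruct (one_point_extension (car C) (atom_in C Blevel) (ident C) set_tri) with
    (k := k) (M := mu) (p := X) (q := Y) (i := i) (j := j)
    as (mu' & Hnet' & Hext & E1 & E2); auto.
  - exact Blevel_ident_atom.
  - intros P Q R (u & v & w & H1 & H2 & H3 & H). exists v, u, w. auto using ctri_swap.
  - intros P Q R (u & v & w & H1 & H2 & H3 & H). exists v, w, u. auto using ctri_rot.
  - intros P Q HP HQ. split.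
    + intros (u & v & w & -> & Pv & Qw & H). apply ctri_ident_l in H as <-.
      now apply Blevel_atoms_eq with v.
    + intros <-. destruct (nonempty P (proj1 (proj2 HP))) as [w Pw].
      exists None, w, w. repeat split; auto. now apply ctri_ident_l.
  - intros P Q HP HQ.
    destruct (nonempty P (proj1 (proj2 (proj1 HP)))) as [u Pu].
    destruct (nonempty Q (proj1 (proj2 (proj1 HQ)))) as [v Qv].
    destruct (Blevel_diversity P u HP Pu) as (x & a & ->).
    destruct (Blevel_diversity Q v HQ Qv) as (y & b & ->).
    destruct (flexible_limit x y) as (f & Hf & Hfl).
    exists (mem (S N) (Limit (cls f))). split; [now apply Blevel_limit|].
    intros R HR. destruct (nonempty R (proj1 (proj2 (proj1 HR)))) as [w Rw].
    destruct (Blevel_diversity R w HR Rw) as (z & c & ->).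
    destruct (Hfl (S N) z c) as [(u' & v' & Hu' & Hv' & H1) H2]. split.
    + now exists u', v', (Some (z, c)).
    + split.
      * destruct (H2 x a) as (v'' & Hv'' & H); [auto|].
        now exists (Some (x, a)), v'', (Some (z, c)).
      * destruct (H2 y b) as (v'' & Hv'' & H); [auto|].
        now exists (Some (y, b)), v'', (Some (z, c)).
  - apply Blevel_triE; auto; try apply HX; try apply HY. now apply (HB i j i).
  - exists mu'. split; [|split; [|auto]].
    + intros l m p Hl Hm Hp. destruct (Hnet' l m Hl Hm) as (H1 & H2 & H3 & H4).
      split; [exact H1|]. split; [|split; [exact H3|]].
      * rewrite (proj2 (proj1 (proj2 (Hnet' l l Hl Hl))) eq_refl). apply set_le_refl.
      * apply Blevel_triE; [apply Hnet'|apply Hnet'|exact H1|]; auto.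
    + intros l m Hl Hm. now apply (Hnet' l m).
Qed.
End TameSubalgebra.

Lemma common_tame (F : list (car C)) :
  (forall f, In f F -> B f) -> exists n, forall f, In f F -> tame n f.
Proof.
  induction F as [|f F IH]; intros HF.
  - exists 0. intros f [].
  - destruct IH as [n Hn]; [auto using in_cons|].
    destruct (B_tame f (HF f (or_introl eq_refl))) as [m Hm].
    exists (max n m). intros g [<-|Hg]; [apply tame_mono with m|apply tame_mono with n];
      auto; lia.
Qed.

(** * A representation of B *)

(** Every level must be witnessed, since a limit label stands for points of arbitrarily large
    index. *)
Definition label_tri (p q r : label) : Prop :=
  forall n, exists u v w, mem n p u /\ mem n q v /\ mem n r w /\ Ctri A PE u v w.

Local Notation div_label := (diversity label valid (Point None)).

Lemma label_tri_id p q : valid p -> valid q -> (label_tri (Point None) p q <-> p = q).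
Proof.
  intros Hp Hq. split.
  - intros H.
    assert (Hpq : forall n, exists w, mem n p w /\ mem n q w).
    { intros n. destruct (H n) as (u & v & w & <- & Hv & Hw & Hc).
      apply ctri_ident_l in Hc as <-. now exists v. }
    destruct p as [u|e], q as [v|f]; simpl in Hpq.
    + destruct (Hpq 0) as (w & -> & ->). reflexivity.
    + exfalso. destruct (Hpq 0) as (w & <- & x & i & -> & _).
      (* At level [S i] the limit no longer contains the point of index [i]. *)
      destruct (Hpq (S i)) as (w & <- & y & j & E & _ & Hj).
      injection E as <- <-. lia.
    + exfalso. destruct (Hpq 0) as (w & (x & i & -> & _) & ->).
      destruct (Hpq (S i)) as (w & (y & j & -> & _ & Hj) & E).
      injection E as <- <-. lia.
    + destruct (Hpq 0) as (w & (x & i & -> & <- & _) & (y & j & E & <- & _)).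
      now injection E as <- <-.
  - intros <- n. destruct (mem_nonempty n p Hp) as [w Hw].
    exists None, w, w. repeat split; auto. now apply ctri_ident_l.
Qed.

Lemma div_label_class p : div_label p ->
  exists x, forall n u, mem n p u -> exists y i, u = Some (y, i) /\ cls y = cls x.
Proof.
  intros [Hp Hne]. destruct p as [[[x i]|]|e].
  - exists x. intros n u <-. now exists x, i.
  - contradiction.
  - destruct (cls_onto e Hp) as [x <-]. exists x.
    intros n u (y & i & -> & Ey & _). now exists y, i.
Qed.

Lemma label_flexible p q : div_label p -> div_label q ->
  exists f, div_label f /\
    forall r, div_label r -> label_tri f f r /\ label_tri p f r /\ label_tri q f r.
Proof.
  intros Hp Hq.
  destruct (div_label_class p Hp) as [x Hx]. destruct (div_label_class q Hq) as [y Hy].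
  destruct (flexible_limit x y) as (f & _ & Hf).
  exists (Limit (cls f)). split; [split; [apply cls_spec|discriminate]|].
  intros r Hr. destruct (div_label_class r Hr) as [z Hz].
  assert (Hr' : forall n, exists z k, mem n r (Some (z, k))).
  { intros n. destruct (mem_nonempty n r (proj1 Hr)) as [w Hw].
    destruct (Hz n w Hw) as (z' & k & -> & _). now exists z', k. }
  split; [|split]; intros n; destruct (Hr' n) as (z' & k & Hw);
    destruct (Hf n z' k) as [(u & v & Hu & Hv & H1) H2].
  - now exists u, v, (Some (z', k)).
  - destruct (mem_nonempty n p (proj1 Hp)) as [u' Hu'].
    destruct (Hx n u' Hu') as (y' & i & -> & E).
    destruct (H2 y' i (or_introl E)) as (v' & Hv' & H).
    now exists (Some (y', i)), v', (Some (z', k)).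
  - destruct (mem_nonempty n q (proj1 Hq)) as [u' Hu'].
    destruct (Hy n u' Hu') as (y' & i & -> & E).
    destruct (H2 y' i (or_intror E)) as (v' & Hv' & H).
    now exists (Some (y', i)), v', (Some (z', k)).
Qed.

(** Invalid labels such as [Limit (ident A)] are enumerated too; requests for them get the default
    answer in [saturated_graph]. *)
Lemma label_countable : exists enum : nat -> label, forall p, exists n, enum n = p.
Proof.
  destruct DAt_inhabited as [d]. destruct DAt_finite as [l Hl]. destruct Afin as [lA HlA].
  exists (fun n => match of_nat n with
    | (0, _) => Point None
    | (1, a) => Limit (nth a lA (ident A))
    | (_, a) => let (b, i) := of_nat a in Point (Some (nth b l d, i))
    end).
  intros [[[x i]|]|e].
  - destruct (In_nth l x d (Hl x)) as (b & _ & Hb).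
    exists (to_nat (2, to_nat (b, i))). rewrite !cancel_of_to. now rewrite Hb.
  - exists (to_nat (0, 0)). now rewrite cancel_of_to.
  - destruct (In_nth lA e (ident A) (HlA e)) as (a & _ & Ha).
    exists (to_nat (1, a)). rewrite cancel_of_to. now rewrite Ha.
Qed.

Lemma label_graph : exists G : nat -> nat -> label,
  (forall k, net label valid (Point None) label_tri k G) /\
  forall u v p q, div_label p -> div_label q -> label_tri p q (G u v) ->
    exists w, G u w = p /\ G w v = q.
Proof.
  destruct label_countable as [enum Henum]. destruct DAt_inhabited as [d].
  apply (saturated_graph label valid (Point None) label_tri) with
    (enum := enum) (p0 := Point (Some (d, 0))).
  - exact I.
  - intros p q r H n. destruct (H n) as (u & v & w & Hu & Hv & Hw & Hc).
    exists v, u, w. auto using ctri_swap.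
  - intros p q r H n. destruct (H n) as (u & v & w & Hu & Hv & Hw & Hc).
    exists v, w, u. auto using ctri_rot.
  - exact label_tri_id.
  - exact label_flexible.
  - split; [exact I|discriminate].
  - exact Henum.
Qed.

(* The ultrafilter of [B] determined by a label: principal for [Point], and
   containing the cofinite subsets of a class for [Limit]. *)
Definition ultra (p : label) (X : car C) : Prop := exists n, forall w, mem n p w -> X w.

Lemma ultra_large p X : ultra p X -> exists n, forall m, n <= m -> forall w, mem m p w -> X w.
Proof.
  intros [n H]. exists n. intros m Hm w Hw. apply H. now apply mem_mono with m.
Qed.

Lemma mem_tame n p u v X : tame n X -> mem n p u -> mem n p v -> X u -> X v.
Proof.
  intros HX Hu Hv. destruct p as [w|e].
  - simpl in *. now subst.
  - apply HX. rewrite mem_limit in Hu, Hv. congruence.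
Qed.

Lemma ultra_not p X : valid p -> ultra p X -> ~ ultra p (compl X).
Proof.
  intros Hp H1 H2. destruct (ultra_large p X H1) as [n1 K1].
  destruct (ultra_large p _ H2) as [n2 K2].
  destruct (mem_nonempty (max n1 n2) p Hp) as [w Hw].
  apply (K2 (max n1 n2)) with w; [lia|exact Hw|]. apply (K1 (max n1 n2)); [lia|exact Hw].
Qed.

(** From the level of [X] on, the points of one label are all inside [X] or all outside. *)
Lemma ultra_compl p X : valid p -> B X -> (ultra p (compl X) <-> ~ ultra p X).
Proof.
  intros Hp HX. split; [intros H1 H2; now apply (ultra_not p X)|].
  intros H. destruct (B_tame X HX) as [n Hn]. exists n. intros w Hw Xw.
  apply H. exists n. intros v Hv. now apply (mem_tame n p w v).
Qed.

Lemma ultra_meet p X Y : ultra p (meet X Y) <-> ultra p X /\ ultra p Y.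
Proof.
  split.
  - intros [n H]. split; exists n; intros w Hw; now apply H.
  - intros [H1 H2]. destruct (ultra_large p X H1) as [n1 K1].
    destruct (ultra_large p _ H2) as [n2 K2]. exists (max n1 n2).
    intros w Hw. split; [apply (K1 (max n1 n2))|apply (K2 (max n1 n2))]; auto; lia.
Qed.

Lemma ultra_join p X Y : valid p -> B X -> B Y ->
  (ultra p (join X Y) <-> ultra p X \/ ultra p Y).
Proof.
  intros Hp HX HY. split.
  - intros [n H]. apply NNPP. intros Hno.
    assert (H1 : ultra p (compl X)) by (apply ultra_compl; tauto).
    assert (H2 : ultra p (compl Y)) by (apply ultra_compl; tauto).
    assert (H3 : ultra p (meet (join X Y) (meet (compl X) (compl Y)))).
    { apply ultra_meet. split; [now exists n|]. now apply ultra_meet. }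
    destruct H3 as [m H3]. destruct (mem_nonempty m p Hp) as [w Hw].
    destruct (H3 w Hw) as [[Xw|Yw] [NX NY]]; [now apply NX|now apply NY].
  - intros [[n H]|[n H]]; exists n; intros w Hw; [left|right]; auto.
Qed.

(** Forwards, a far out point of [p] splits into sides in [X] and [Y]; their truncations are the
    labels sought, and [ctri_refine] lifts the triangle to every level. Backwards, one triangle
    beyond the levels of [X] and [Y] suffices, because the product is tame. *)
Lemma ultra_comp p X Y : valid p -> B X -> B Y ->
  (ultra p (comp X Y) <->
   exists q r, valid q /\ valid r /\ label_tri q r p /\ ultra q X /\ ultra r Y).
Proof.
  intros Hp HX HY.
  destruct (B_tame X HX) as [nX TX]. destruct (B_tame Y HY) as [nY TY].
  split.
  - intros H. destruct (ultra_large p _ H) as [n Hn].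
    (* The level [m] must be such that truncating [w] gives back [p] itself; for a point this means
       exceeding its index. *)
    assert (Hred : exists m w, nX <= m /\ nY <= m /\ n <= m /\ mem m p w /\ red m w = p).
    { destruct p as [[[x i]|]|e].
      - exists (S (i + nX + nY + n)), (Some (x, i)). repeat split; try lia.
        unfold red. destruct (Nat.leb_spec (S (i + nX + nY + n)) i); [lia|reflexivity].
      - exists (nX + nY + n), None. repeat split; lia.
      - destruct (mem_nonempty (nX + nY + n) (Limit e) Hp) as [w Hw].
        exists (nX + nY + n), w. repeat split; try lia; [exact Hw|now apply mem_limit]. }
    destruct Hred as (m & w & HmX & HmY & Hm & Hw & E).
    destruct (Hn m Hm w Hw) as (u & v & Xu & Yv & Hc).
    exists (red m u), (red m v). split; [apply red_valid|]. split; [apply red_valid|].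
    split; [|split].
    + intros k. destruct (mem_nonempty (max m k) p Hp) as [w' Hw'].
      destruct (ctri_refine m (max m k) u v w w') as (u' & v' & Hu' & Hv' & Hc');
        [lia|exact Hc|now rewrite E|].
      exists u', v', w'. repeat split; auto; apply mem_mono with (max m k); auto; lia.
    + exists m. intros u' Hu'. apply (tame_mono nX m X HmX TX) with u; [|exact Xu].
      symmetry. now apply (mem_red_eq m m).
    + exists m. intros v' Hv'. apply (tame_mono nY m Y HmY TY) with v; [|exact Yv].
      symmetry. now apply (mem_red_eq m m).
  - intros (q & r & Hq & Hr & Ht & H1 & H2).
    destruct (ultra_large q X H1) as [n1 K1]. destruct (ultra_large r Y H2) as [n2 K2].
    set (n := n1 + n2 + nX + nY). exists n.
    destruct (Ht n) as (u & v & w & Hu & Hv & Hw & Hc).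
    intros w' Hw'. apply (mem_tame n p w w'); auto.
    + apply subuniverse_comp; [apply tame_subuniverse| |].
      * apply tame_mono with nX; [lia|exact TX].
      * apply tame_mono with nY; [lia|exact TY].
    + exists u, v. split; [apply (K1 n); [lia|exact Hu]|].
      split; [apply (K2 n); [lia|exact Hv]|exact Hc].
Qed.

(** A pair is related by [X] when [X] lies in the ultrafilter of its label. Products are preserved
    by [ultra_comp] and saturation; injectivity holds because every point occurs as a label. *)
Lemma B_representable : representable_in C B.
Proof.
  destruct label_graph as (G & HG & Hsat).
  assert (Gval : forall u v, valid (G u v)).
  { intros u v. apply (HG (S (max u v))); lia. }
  assert (Gid : forall u v, G u v = Point None <-> u = v).
  { intros u v. apply (HG (S (max u v))); lia. }
  assert (Gsym : forall u v, G u v = G v u).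
  { intros u v. apply (HG (S (max u v))); lia. }
  assert (Gtri : forall u v w, label_tri (G u w) (G w v) (G u v)).
  { intros u v w. apply (HG (S (u + v + w))); lia. }
  (* Saturation covers diversity labels only; for an identity label the witness is [u] or [v]
     itself. *)
  assert (Gsat : forall u v p q, valid p -> valid q -> label_tri p q (G u v) ->
    exists w, G u w = p /\ G w v = q).
  { intros u v p q Hp Hq Ht.
    destruct (classic (p = Point None)) as [->|Np].
    { apply label_tri_id in Ht as ->; auto. exists u. split; [now apply Gid|reflexivity]. }
    destruct (classic (q = Point None)) as [->|Nq].
    { assert (Ht' : label_tri (Point None) p (G u v)).
      { intros n. destruct (Ht n) as (a & b & c & Ha & Hb & Hc & H).
        exists b, a, c. auto using ctri_swap. }
      apply label_tri_id in Ht' as ->; auto. exists v. split; [reflexivity|now apply Gid]. }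
    apply Hsat; [split|split|]; auto. }
  assert (Gonto : forall p, valid p -> exists u v, G u v = p).
  { intros p Hp. destruct (Gsat 0 0 p p Hp Hp) as (w & Hw & _); [|now exists 0, w].
    rewrite (proj2 (Gid 0 0) eq_refl). intros n.
    destruct (mem_nonempty n p Hp) as [u Hu]. exists u, u, None.
    repeat split; auto. now apply ctri_ident_r. }
  exists nat, (fun _ _ => True), (fun X u v => ultra (G u v) X).
  unfold is_rep.
  refine (conj _ (conj _ (conj _ (conj _ (conj _ (conj _ (conj _ (conj _ (conj _ (conj _
    (conj _ _))))))))))); auto.
  - intros X Y HX HY u v. now apply ultra_join.
  - intros X Y HX HY u v. apply ultra_meet.
  - intros X HX u v. rewrite ultra_compl; auto. tauto.
  - intros u v. split; [|intros []]. intros [n H].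
    destruct (mem_nonempty n (G u v) (Gval u v)) as [w Hw]. exact (H w Hw).
  - intros u v. split; [auto|]. intros _. exists 0. intros w _. exact I.
  - intros u v. split.
    + intros [n H]. split; [exact I|]. apply Gid.
      destruct (mem_nonempty n (G u v) (Gval u v)) as [w Hw]. assert (E := H w Hw).
      simpl in E. subst w. destruct (G u v) as [a|e]; [simpl in Hw; now subst|].
      destruct Hw as (x & i & E & _). discriminate.
    + intros [_ <-]. exists 0. rewrite (proj2 (Gid u u) eq_refl). simpl. auto.
  - intros X HX u v. simpl. rewrite Gsym. tauto.
  - intros X Y HX HY u v. rewrite ultra_comp; auto. split.
    + intros (q & r & Hq & Hr & Ht & H1 & H2).
      destruct (Gsat u v q r Hq Hr Ht) as (w & <- & <-). now exists w.
    + intros (w & H1 & H2). exists (G u w), (G w v). auto.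
  - intros X Y HX HY H. apply set_eq. intros w.
    destruct (Gonto (Point w) I) as (u & v & E). specialize (H u v). rewrite E in H.
    assert (Hw : forall Z, ultra (Point w) Z <-> Z w).
    { intros Z. split; [intros [n HZ]; now apply HZ|]. intros HZ. exists 0. now intros v' <-. }
    now rewrite !Hw in H.
Qed.

(** * Absence of complete representations *)

Section Colouring.
Variables (U : Type) (EU : U -> U -> Prop) (h : car C -> U -> U -> Prop).
Hypothesis Hrep : is_rep C B U EU h.

(** Since [1' <= x^(i);x^(i)], a fixed point has an [x^(i)]-neighbour for every [i]; these are
    distinct because different points of [C] are disjoint. So every representation has an infinite
    block. *)
Lemma rep_star (x : D) : exists v : nat -> U,
  forall i j, i <> j -> v i <> v j /\ EU (v i) (v j).
Proof.
  destruct Hrep as (Hsymm & Htrans & HsubE & _ & Hmeet & _ & Hzero & Hone & Hid & _ & Hcomp & Hfaith).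
  assert (HB := B_subuniverse).
  assert (Hpair : exists u v, EU u v).
  { apply NNPP. intros Hno. absurd (zero C = one C).
    - intros E. assert (H : one C None) by exact I. rewrite <- E in H. exact H.
    - apply Hfaith; [exact (proj1 HB)|exact (proj1 (proj2 HB))|]. intros u v. rewrite Hzero, Hone.
      split; [intros []|]. intros H. apply Hno. now exists u, v. }
  destruct Hpair as (u & u' & Huu').
  assert (Hu : EU u u) by (apply Htrans with u'; auto).
  assert (Hv : forall i, exists v, h (point (Some (x, i))) u v).
  { intros i.
    assert (H : h (comp (point (Some (x, i))) (point (Some (x, i)))) u u).
    { apply (rep_mono C B U EU h (ident C)); auto.
      - exact (proj1 (proj2 (proj2 HB))).
      - apply subuniverse_comp; auto using B_point.
      - apply set_le. intros w ->. do 2 eexists.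
        split; [reflexivity|]. split; [reflexivity|]. now apply ctri_ident_r.
      - apply Hid. auto. }
    apply Hcomp in H as (v & H & _); try exact (B_point _). now exists v. }
  set (v := fun i => proj1_sig (constructive_indefinite_description _ (Hv i))).
  assert (v_spec : forall i, h (point (Some (x, i))) u (v i)).
  { intros i. exact (proj2_sig (constructive_indefinite_description _ (Hv i))). }
  exists v. intros i j Nij. split.
  - intros E. assert (Hm : h (meet (point (Some (x, i))) (point (Some (x, j)))) u (v i)).
    { apply Hmeet; try exact (B_point _). split; [|rewrite E]; apply v_spec. }
    apply (Hzero u (v i)).
    replace (zero C) with (@meet C (point (Some (x, i))) (point (Some (x, j)))); [exact Hm|].
    apply set_eq. intros w. split; [|intros []]. intros [-> E']. unfold point in E'.
    injection E' as ->. now apply Nij.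
  - apply Htrans with u; [apply Hsymm|].
    + apply (HsubE _ (B_point (Some (x, i)))), v_spec.
    + apply (HsubE _ (B_point (Some (x, j)))), v_spec.
Qed.

Lemma no_triangle_free_colouring (R : D -> U -> U -> Prop) :
  (forall u v, EU u v -> u <> v -> exists x, R x u v) ->
  exists x u v w, R x u v /\ R x v w /\ R x u w.
Proof.
  intros HR. destruct DAt_inhabited as [d]. destruct DAt_finite as [l Hl].
  destruct (rep_star d) as [v Hv].
  destruct (ramsey_triangle D (fun x i j => R x (v i) (v j)) l (fun _ => True))
    as (x & i & j & k & _ & H1 & H2 & H3).
  - intros n. now exists n.
  - intros i j _ _ Hij. destruct (Hv i j) as [Nv Ev]; [lia|].
    destruct (HR _ _ Ev Nv) as [x Hx]. exists x. auto.
  - exists x, (v i), (v j), (v k). auto.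
Qed.

Lemma rep_point_triangle a b c u v w :
  h (point a) u w -> h (point b) w v -> h (point c) u v -> Ctri A PE a b c.
Proof.
  destruct Hrep as (_ & _ & _ & _ & Hmeet & _ & Hzero & _ & _ & _ & Hcomp & _).
  intros Ha Hb Hc. apply NNPP. intros Hno. apply (Hzero u v).
  replace (zero C) with (@meet C (point c) (comp (point a) (point b))).
  - apply Hmeet.
    + apply B_point.
    + apply subuniverse_comp; auto using B_point, B_subuniverse.
    + split; [exact Hc|]. apply Hcomp; try exact (B_point _). now exists w.
  - apply set_eq. intros z. split; [|intros []].
    intros [-> (a' & b' & -> & -> & H)]. exact (Hno H).
Qed.
End Colouring.

Hypothesis no_cycles : forall u, atom_in A (fun _ => True) u -> u <> ident A ->
  meet (comp u u) u = zero A.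

Lemma no_tri (x : D) : ~ tri x x x.
Proof.
  intros H. apply (proj1 (proj2 (DAt_atom x))).
  rewrite <- (no_cycles (proj1_sig x)).
  - apply (ra_le_antisym A HA).
    + apply (ra_meet_glb A HA); [exact H|apply (ra_le_refl A HA)].
    + apply (ra_meet_r A HA).
  - apply DAt_atom.
  - intros E. apply (proj1 (proj2 Aint)). apply (ra_le_contradict A HA) with (ident A).
    + apply (ra_le_refl A HA).
    + rewrite <- E at 1. apply (proj2_sig x).
Qed.

Lemma no_ctri (x : D) i j k : ~ Ctri A PE (Some (x, i)) (Some (x, j)) (Some (x, k)).
Proof. intros H. apply ctri_points in H as [H _]. exact (no_tri x H). Qed.

(** The unit is the supremum of the points, so a complete representation puts each pair of distinct
    related elements into some [x^(i)]. Forgetting the index leaves finitely many colours. *)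
Lemma B_not_completely_representable : ~ completely_representable_in C B.
Proof.
  intros (U & EU & h & Hrep & Hcr).
  destruct (no_triangle_free_colouring U EU h Hrep
    (fun x u v => exists i, h (point (Some (x, i))) u v)) as (x & u & v & w & H1 & H2 & H3).
  - intros u v Huv Nuv.
    assert (Hone : h (one C) u v).
    { destruct Hrep as (_ & _ & _ & _ & _ & _ & _ & Hone & _). now apply Hone. }
    apply (Hcr (fun X => exists a, X = point a)) in Hone as (X & [a ->] & Ha).
    + destruct a as [[x i]|]; [now exists x, i|]. exfalso. apply Nuv.
      destruct Hrep as (_ & _ & _ & _ & _ & _ & _ & _ & Hid & _). now apply Hid.
    + intros X [a ->]. apply B_point.
    + split; [exact (proj1 (proj2 B_subuniverse))|]. split; [intros X _; now apply set_le|].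
      intros T _ HT. apply set_le. intros a _.
      assert (Ha := HT (point a) (ex_intro _ a eq_refl)). rewrite set_le in Ha.
      now apply Ha.
  - destruct H1 as [i H1], H2 as [j H2], H3 as [k H3].
    apply (no_ctri x i j k).
    exact (rep_point_triangle U EU h Hrep _ _ _ _ _ _ H1 H2 H3).
Qed.

Lemma completion_not_representable (F : ra_sig) :
  completion_of C B F -> ~ representable_in F (fun _ => True).
Proof.
  intros (_ & Hcomplete & e & He & Hdense) (U & EU & h & HF).
  assert (Hrep : is_rep C B U EU (fun X => h (e X))).
  { destruct He as (E1 & E2 & E3 & E4 & E5 & E6 & E7 & E8 & E9).
    assert (HB := B_subuniverse).
    destruct HF as (K1 & K2 & K3 & K4 & K5 & K6 & K7 & K8 & K9 & K10 & K11 & K12).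
    unfold is_rep.
    refine (conj K1 (conj K2 (conj _ (conj _ (conj _ (conj _ (conj _ (conj _ (conj _ (conj _
      (conj _ _))))))))))); intros.
    - now apply K3 with (e x).
    - rewrite E1; auto.
    - rewrite E2; auto.
    - rewrite E3; auto.
    - rewrite E4; auto.
    - rewrite E5; auto.
    - rewrite E6; auto.
    - rewrite E7; auto.
    - rewrite E8; auto.
    - apply E9; auto. }
  destruct (choice (fun (x : D) s =>
    is_sup_in F (fun _ => True) (fun d => exists i, d = e (point (Some (x, i)))) s))
    as [s Hs].
  { intros x. apply Hcomplete. }
  (* The representation need not preserve suprema, but a relation meeting the
     image of a supremum meets the image of some joinand. *)
  assert (Hsup : forall x d u v, h (s x) u v -> h d u v ->
    exists i u' v', h (e (point (Some (x, i)))) u' v' /\ h d u' v').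
  { intros x d u v H1 H2. apply NNPP. intros Hno.
    destruct HF as (_ & _ & HsubE & Hjoin & _ & Hcompl & _ & _ & _ & _ & _ & Hfaith).
    assert (Hle : le (s x) (compl d)).
    { apply (Hs x); [exact I|]. intros y [i ->].
      apply Hfaith; auto. intros a b. rewrite Hjoin, Hcompl by exact I.
      split; [|tauto]. intros [H|H]; [|exact H].
      split; [now apply (HsubE _ I) in H|]. intros H'. apply Hno. now exists i, a, b. }
    unfold le in Hle.
    assert (H3 : h (compl d) u v) by (rewrite <- Hle; apply Hjoin; auto).
    apply Hcompl in H3; [|exact I]. tauto. }
  destruct (no_triangle_free_colouring U EU (fun X => h (e X)) Hrep
    (fun x => h (s x))) as (x & u & v & w & H1 & H2 & H3).
  - intros u v Huv Nuv. apply NNPP. intros Hno.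
    destruct DAt_finite as [l Hl].
    destruct HF as (_ & _ & _ & Hjoin & _ & Hcompl & Hzero & _ & Hid & _).
    (* As [D] is finite, the coloured pairs and the diagonal form the image of one element [t]. If
       its complement were nonzero, density would put the image of a point below it, yet that image
       also lies below [t]. *)
    assert (Hcover : exists t, forall a b,
      h t a b <-> (EU a b /\ a = b) \/ exists x, In x l /\ h (s x) a b).
    { clear Hl. induction l as [|y l [t Ht]].
      - exists (ident F). intros a b. rewrite Hid.
        split; [now left|]. now intros [H|(x & [] & _)].
      - exists (join (s y) t). intros a b. rewrite Hjoin, Ht by exact I.
        split.
        + intros [H|[H|(x & Hx & H)]]; [right|left|right]; auto.
          * exists y. split; [now left|exact H].
          * exists x. split; [now right|exact H].
        + intros [H|(x & [<-|Hx] & H)]; auto.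
          right. right. now exists x. }
    destruct Hcover as [t Ht].
    assert (Hnt : h (compl t) u v).
    { apply Hcompl; [exact I|]. split; [exact Huv|]. rewrite Ht.
      intros [[_ E]|(x & _ & H)]; [now apply Nuv|]. apply Hno. now exists x. }
    destruct (Hdense (compl t)) as (b & Bb & Nb & Hle).
    { intros E. rewrite E in Hnt. now apply Hzero in Hnt. }
    destruct (nonempty b) as [z bz].
    { intros ->. apply Nb. apply He. }
    assert (Hz : exists u' v', h (e (point z)) u' v').
    { apply NNPP. intros Hno'. apply (proj1 (proj2 (point_atom z))).
      destruct Hrep as (_ & _ & _ & _ & _ & _ & Hzero' & _ & _ & _ & _ & Hfaith).
      apply Hfaith; [apply B_point|exact (proj1 B_subuniverse)|].
      intros u' v'. rewrite Hzero'. split; [|intros []]. intros H. apply Hno'. now exists u', v'. }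
    destruct Hz as (u' & v' & Hz).
    assert (Hz' : h (e b) u' v').
    { apply (rep_mono C B U EU _ (point z) b Hrep); auto using B_point.
      apply set_le. now intros ? ->. }
    assert (Hz2 : h (compl t) u' v').
    { unfold le in Hle. rewrite <- Hle. apply Hjoin; auto. }
    apply Hcompl in Hz2 as [Euv Hz2]; [|exact I]. apply Hz2, Ht.
    destruct z as [[x i]|].
    + right. exists x. split; [apply Hl|].
      destruct (Hs x) as (_ & Hub & _). specialize (Hub _ (ex_intro _ i eq_refl)).
      unfold le in Hub. rewrite <- Hub. apply Hjoin; auto.
    + left. destruct Hrep as (_ & _ & _ & _ & _ & _ & _ & _ & Hid' & _).
      now apply Hid'.
  - assert (HF' := HF).
    destruct HF' as (_ & _ & _ & _ & _ & _ & _ & _ & _ & Hconv & Hcomp & _).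
    (* The three sides in [s x] are replaced one at a time by sides in [x^(k)], [x^(i)] and [x^(j)].
       Each use of [Hsup] moves to another pair, with the other two sides carried along as a
       composite; converses are written out because symmetry is known only for [B]. *)
    assert (Hc1 : h (comp (s x) (s x)) u w) by (apply Hcomp; eauto).
    destruct (Hsup x _ u w H3 Hc1) as (k & u1 & w1 & Hk & Hc2).
    apply Hcomp in Hc2 as (v1 & Ha & Hb); auto.
    assert (Hc3 : h (comp (e (point (Some (x, k)))) (conv (s x))) u1 v1).
    { apply Hcomp; auto. exists w1. split; [exact Hk|]. now apply Hconv. }
    destruct (Hsup x _ u1 v1 Ha Hc3) as (i & u2 & v2 & Hi & Hc4).
    apply Hcomp in Hc4 as (w2 & Hk2 & Hb2); auto. apply (Hconv (s x) I) in Hb2.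
    assert (Hi' : h (e (point (Some (x, i)))) v2 u2).
    { destruct Hrep as (_ & _ & _ & _ & _ & _ & _ & _ & _ & Hconv' & _).
      now apply (Hconv' (point (Some (x, i))) (B_point _) v2 u2). }
    assert (Hc5 : h (comp (e (point (Some (x, i)))) (e (point (Some (x, k))))) v2 w2).
    { apply Hcomp; eauto. }
    destruct (Hsup x _ v2 w2 Hb2 Hc5) as (j & v3 & w3 & Hj & Hc6).
    apply Hcomp in Hc6 as (u3 & Hi3 & Hk3); auto.
    apply (no_ctri x i k j).
    exact (rep_point_triangle U EU _ Hrep _ _ _ _ _ _ Hi3 Hk3 Hj).
Qed.

End SpecialExtension.

Theorem theorem2 (A : ra_sig) (PE : car A -> Prop) :
  (* A is a finite symmetric integral relation algebra *)
  is_RA A -> finite_ra A -> symmetric_ra A -> integral_in A (fun _ => True) ->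
  (* E is a (finite, symmetric) integral subalgebra of A *)
  subuniverse A PE -> integral_in A PE ->
  special_extension A PE ->
  has_flexible_trio A PE ->
  (* (i) *)
  (forall F : list (car (CEA A PE)),
     (forall f, In f F -> Bsub A PE f) ->
     exists Q : car (CEA A PE) -> Prop,
       subuniverse (CEA A PE) Q /\ (forall x, Q x -> Bsub A PE x) /\
       (forall x, generated (CEA A PE) (fun y => In y F) x -> Q x) /\
       one_point_ext (CEA A PE) Q) /\
  (* (ii) *)
  representable_in (CEA A PE) (Bsub A PE) /\
  (* (iii) *)
  ((forall u, atom_in A (fun _ => True) u -> u <> ident A ->
      meet (comp u u) u = zero A) ->
   ~ completely_representable_in (CEA A PE) (Bsub A PE) /\
   forall D : ra_sig, completion_of (CEA A PE) (Bsub A PE) D ->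
     ~ representable_in D (fun _ => True)).
Proof.
  intros HA Hfin Hsym Hint HE _ Hspec Htrio.
  split; [|split].
  - intros F HF.
    destruct (common_tame A PE HA Hfin Hsym HE Hspec F HF) as [n Hn].
    (* The finitely many generators share the level [n], and the subalgebra has level [n + 1]. *)
    exists (Blevel A PE HA Hfin HE n).
    split; [|split; [|split]].
    + now apply Blevel_subuniverse.
    + now intros x [].
    + intros x Hx. apply Hx; [now apply Blevel_subuniverse|].
      intros f Hf. split; [now apply HF|]. apply tame_mono with n; auto.
    + now apply Blevel_one_point_ext.
  - now apply B_representable.
  - intros Hcyc. split.
    + now apply B_not_completely_representable.
    + intros D. now apply completion_not_representable.
Qed.
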